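(* Let $(X,g^+)$ be an $(n+1)$-dimensional asymptotically hyperbolic (AH) manifold of $C^2$ regularity. Then for any $q\in X$ and $p>1$, $$\mathrm{cap}_p(B_{g^+}(q,t))=O(e^{nt}),\qquad t\to+\infty.$$
   Context: Let $\overline X$ be a compact connected smooth $(n+1)$-manifold with boundary, with interior $X$ and boundary $\partial X$. A smooth defining function is a smooth $\rho$ on $\overline X$ with $\rho>0$ in $X$, $\rho=0$ and $d\rho\ne0$ on $\partial X$. A complete noncompact metric $g^+$ on $X$ is $C^{m,\alpha}$ conformally compact if, for some such $\rho$, $g=\rho^2g^+$ extends to a $C^{m,\alpha}$ metric on $\overline X$. $(X,g^+)$ is asymptotically hyperbolic (AH) if $g^+$ is at least $C^2$ conformally compact and $|d\rho|^2_{g}=1$ on $\partial X$; it is of $C^{2}$ regularity if $g^+$ is $C^{2}$ conformally compact. For a Riemannian manifold $(M,g)$, a compact set $F\subseteq M$ and $p\ge1$, the $p$-capacity is $\mathrm{cap}_p(F)=\inf_u\int_M|\nabla u|^p\,dV_g$, the infimum being over all Lipschitz functions $u$ with compact support in $M$ and $u=1$ on $F$. Here it is taken in $(X,g^+)$, with $B_{g^+}(q,t)$ the (closed) geodesic ball of radius $t$ centered at $q$. *)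

(* Defs.v *)
From HB Require Import structures.
From mathcomp Require Import all_boot all_order all_algebra.
From mathcomp Require Import all_classical all_reals all_analysis.

Set Implicit Arguments.
Unset Strict Implicit.
Unset Printing Implicit Defensive.

Import Order.TTheory GRing.Theory Num.Theory.
Import numFieldNormedType.Exports.

Local Open Scope classical_set_scope.
Local Open Scope ring_scope.

Section HalfSpace.
Context {R : realType} {n : nat}.
Local Notation E := 'rV[R]_n.+1.
Implicit Types (V : set E) (f : E -> R) (v : E).

Definition half_space : set E := [set v | 0 <= v ord0 ord0].

(* The increment is restricted to those h that stay in V: when V is relatively
   open in half_space this is the usual partial derivative, except in the
   normal direction at a point of the boundary hyperplane, where it is the
   one-sided derivative. *)
Definition diff_quot (j : 'I_n.+1) f v (h : R) : R :=
  h^-1 * (f (v + h *: delta_mx ord0 j) - f v).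

Definition pder_filter V (j : 'I_n.+1) v : set_system R :=
  within [set h | V (v + h *: delta_mx ord0 j)] 0^'.

Definition pder V (j : 'I_n.+1) f v : R :=
  lim (diff_quot j f v @ pder_filter V j v).

(* Class C^k up to the boundary: the partial derivatives of order at most k
   exist and are continuous on V, boundary points included. *)
Fixpoint Ck (k : nat) V f : Prop :=
  {within V, continuous f} /\
  (if k is k'.+1 then
     forall j, (forall v, V v -> cvg (diff_quot j f v @ pder_filter V j v)) /\
               Ck k' V (pder V j f)
   else True).

Definition grad V f v : E := \row_j pder V j f v.

End HalfSpace.

Section LebesgueRV.
Context {R : realType} {n : nat}.
Local Notation E := 'rV[R]_n.+1.
Local Open Scope ereal_scope.

Definition borel_rV := g_sigma_algebraType (@open E).

(* Volume of the smallest box containing A, +oo if A is unbounded. *)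
Definition box_gauge (A : set borel_rV) : \bar R :=
  ereal_inf [set (\prod_(i < n.+1) (ab.2 ord0 i - ab.1 ord0 i)%R)%:E |
    ab in [set ab : E * E | (forall i, ab.1 ord0 i <= ab.2 ord0 i)%R /\
      forall v, A v -> forall i,
        (ab.1 ord0 i <= (v : E) ord0 i <= ab.2 ord0 i)%R]].

Lemma box_gauge_ge0 A : 0 <= box_gauge A.
Proof.
apply: le_ereal_inf_tmp => _ [ab [le_ab _] <-]; rewrite lee_fin.
by apply: prodr_ge0 => i _; rewrite subr_ge0.
Qed.

Lemma box_gauge0 : box_gauge set0 = 0.
Proof.
apply/eqP; rewrite eq_le box_gauge_ge0 andbT.
apply: ereal_inf_lbound; exists (0%R, 0%R); first by split.
by rewrite /= (bigD1 ord0) //= subrr mul0r.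
Qed.

(* Lebesgue outer measure, by coverings with countably many boxes. *)
Definition lebesgue_rV : set E -> \bar R := mu_ext box_gauge.

HB.instance Definition _ := isOuterMeasure.Build R E lebesgue_rV
  (mu_ext0 box_gauge0 box_gauge_ge0) (mu_ext_ge0 box_gauge_ge0)
  (le_mu_ext box_gauge) (mu_ext_sigma_subadditive box_gauge_ge0).

Definition lebesgue_rV_outer : {outer_measure set E -> \bar R} := lebesgue_rV.

Definition lebesgue_rV_measure :
    {measure set (caratheodory_type lebesgue_rV_outer) -> \bar R} :=
  lebesgue_rV_outer : set (caratheodory_type lebesgue_rV_outer) -> \bar R.

End LebesgueRV.
Arguments lebesgue_rV_measure : clear implicits.

(* A smooth atlas on M with values in the closed half-space of dimension n+1;
   chartV i is the inverse of chart i, with arbitrary values outside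
   chart i @` dom i, and chart_at selects a chart around each point. *)
Record smooth_atlas (R : realType) (n : nat) (M : ptopologicalType) := {
  chart_idx : Type ;
  dom : chart_idx -> set M ;
  chart : chart_idx -> M -> 'rV[R]_n.+1 ;
  chartV : chart_idx -> 'rV[R]_n.+1 -> M ;
  chart_at : M -> chart_idx ;
  dom_chart_at : forall x, dom (chart_at x) x ;
  dom_open : forall i, open (dom i) ;
  chart_open : forall i, exists2 O, open O & chart i @` dom i = O `&` half_space ;
  chartK : forall i x, dom i x -> chartV i (chart i x) = x ;
  chart_continuous : forall i, {within dom i, continuous (chart i)} ;
  chartV_continuous : forall i,
    {within chart i @` dom i, continuous (chartV i)} ;
  transition_smooth : forall i j (k : nat) (b : 'I_n.+1),
    Ck k (chart i @` (dom i `&` dom j))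
      (fun v => chart j (chartV i v) ord0 b)
}.

Section Manifold.
Context {R : realType} {n : nat} {M : ptopologicalType}.
Variable A : smooth_atlas R n M.
Local Notation E := 'rV[R]_n.+1.
Local Notation dom := (@dom _ _ _ A).
Local Notation chart := (@chart _ _ _ A).
Local Notation chartV := (@chartV _ _ _ A).
Local Notation chart_idx := (chart_idx A).

Definition bdry : set M := [set x | exists2 i, dom i x & chart i x ord0 ord0 = 0].
Definition inner : set M := ~` bdry.

Definition smooth (f : M -> R) :=
  forall i k, Ck k (chart i @` dom i) (f \o chartV i).

(* Components of df at x in the chart i. *)
Definition dchart (i : chart_idx) (f : M -> R) (x : M) : E :=
  grad (chart i @` dom i) (f \o chartV i) (chart i x).

(* Row-vector convention: v *m transition_jac i j x are the components in the
   chart j of the vector at x whose components in the chart i are v. *)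
Definition transition_jac (i j : chart_idx) (x : M) : 'M[R]_n.+1 :=
  \matrix_(a, b) pder (chart i @` (dom i `&` dom j)) a
    (fun v => chart j (chartV i v) ord0 b) (chart i x).

(* g i x is the matrix of the metric at x in the chart i; only the values at
   x in dom i are meaningful. *)
Definition metric_field := chart_idx -> M -> 'M[R]_n.+1.

Definition posdef (G : 'M[R]_n.+1) :=
  G^T = G /\ forall v : E, v != 0 -> 0 < (v *m G *m v^T) ord0 ord0.

Definition is_metric (k : nat) (S : set M) (g : metric_field) :=
  [/\ forall i x, dom i x -> S x -> posdef (g i x),
      forall i a b, Ck k (chart i @` (dom i `&` S))
        (fun v => g i (chartV i v) a b)
    & forall i j x, dom i x -> dom j x -> S x ->
        g i x = transition_jac i j x *m g j x *m (transition_jac i j x)^T].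

Definition covector_norm2 (G : 'M[R]_n.+1) (w : E) : R :=
  (w *m invmx G *m w^T) ord0 ord0.

Section Metric.
Variable g : metric_field.

Definition arc_length (i : chart_idx) (c : R -> E) : R :=
  \int[lebesgue_measure]_(t in `[0, 1])
    Num.sqrt (('D_1 c t *m g i (chartV i (c t)) *m ('D_1 c t)^T) ord0 ord0).

(* path_length x y l: some piecewise C^1 curve in the interior from x to y has
   length l; the curve is cut into C^1 arcs, each parametrized by [0, 1] and
   contained in the domain of a chart, where c is its expression. *)
Inductive path_length : M -> M -> R -> Prop :=
| path_nil x : path_length x x 0
| path_cons i (c : R -> E) y l :
    (forall t, derivable c t 1) -> continuous ('D_1 c) ->
    (forall t, 0 <= t <= 1 -> (chart i @` (dom i `&` inner)) (c t)) ->
    path_length (chartV i (c 1)) y l ->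
    path_length (chartV i (c 0)) y (arc_length i c + l).

Definition geodist (x y : M) : \bar R :=
  ereal_inf [set l%:E | l in path_length x y].

Definition geoball (q : M) (t : R) : set M :=
  [set x | inner x /\ (geodist q x <= t%:E)%E].

Definition complete_metric :=
  forall x : nat -> M, (forall k, inner (x k)) ->
    (forall e : R, 0 < e -> exists N, forall k l, (N <= k)%N -> (N <= l)%N ->
      (geodist (x k) (x l) < e%:E)%E) ->
    exists2 y, inner y & forall e : R, 0 < e -> exists N, forall k, (N <= k)%N ->
      (geodist (x k) y < e%:E)%E.

Definition borel_mfd := g_sigma_algebraType (@open M).

Definition volume_gauge (B : set borel_mfd) : \bar R :=
  ereal_inf [set (\int[lebesgue_rV_measure R n]_(v in chart i @` B)
      (Num.sqrt (\det (g i (chartV i v))))%:E)%E |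
    i in [set i : chart_idx | B `<=` dom i `&` inner]].

Lemma volume_gauge_ge0 B : (0 <= volume_gauge B)%E.
Proof.
apply: le_ereal_inf_tmp => _ [i _ <-].
by apply: integral_ge0 => v _; rewrite lee_fin sqrtr_ge0.
Qed.

Lemma volume_gauge0 : volume_gauge set0 = 0%E.
Proof.
apply/eqP; rewrite eq_le volume_gauge_ge0 andbT.
apply: ereal_inf_lbound; exists (chart_at A point); first by [].
by rewrite image_set0 integral_set0.
Qed.

(* Riemannian measure of the interior: the Caratheodory extension of the local
   formula \int sqrt(det g) dv for Borel sets contained in the domain of a
   chart. On such sets the formula does not depend on the chart (change of
   variables) and is countably additive, so the extension agrees with it. *)
Definition volume : set M -> \bar R := mu_ext volume_gauge.

HB.instance Definition _ := isOuterMeasure.Build R M volume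
  (mu_ext0 volume_gauge0 volume_gauge_ge0) (mu_ext_ge0 volume_gauge_ge0)
  (le_mu_ext volume_gauge) (mu_ext_sigma_subadditive volume_gauge_ge0).

Definition volume_outer : {outer_measure set M -> \bar R} := volume.

Definition volume_measure :
    {measure set (caratheodory_type volume_outer) -> \bar R} :=
  volume_outer : set (caratheodory_type volume_outer) -> \bar R.

(* |\nabla u| = |du|; the chart is irrelevant where u is differentiable, that
   is, almost everywhere when u is Lipschitz. *)
Definition grad_norm (u : M -> R) (x : M) : R :=
  let i := chart_at A x in Num.sqrt (covector_norm2 (g i x) (dchart i u x)).

Definition lipschitz_inner (u : M -> R) := exists2 L : R, 0 <= L &
  forall x y, inner x -> inner y ->
    (`|u x - u y|%:E <= L%:E * geodist x y)%E.

Definition compactly_supported_inner (u : M -> R) := exists2 K : set M,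
  compact K /\ K `<=` inner & forall x, inner x -> ~ K x -> u x = 0.

Definition capacity (p : R) (F : set M) : \bar R :=
  ereal_inf [set (\int[volume_measure]_(x in inner) (grad_norm u x `^ p)%:E)%E |
    u in [set u : M -> R | [/\ lipschitz_inner u, compactly_supported_inner u &
                               forall x, F x -> u x = 1]]].

End Metric.

Definition defining_function (rho : M -> R) :=
  [/\ smooth rho,
      forall x, inner x -> 0 < rho x,
      forall x, bdry x -> rho x = 0
    & forall i x, dom i x -> bdry x -> dchart i rho x != 0].

Definition conformal_compactification (k : nat) (gplus : metric_field)
    (rho : M -> R) (gbar : metric_field) :=
  [/\ defining_function rho, is_metric k setT gbar
    & forall i x, dom i x -> inner x -> gbar i x = rho x ^+ 2 *: gplus i x].

Definition asymptotically_hyperbolic (k : nat) (gplus : metric_field) :=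
  [/\ (2 <= k)%N, is_metric k inner gplus, complete_metric gplus, ~ compact inner
    & exists rho gbar, conformal_compactification k gplus rho gbar /\
        forall i x, dom i x -> bdry x ->
          covector_norm2 (gbar i x) (dchart i rho x) = 1].

End Manifold.

(* Main.v *)
From HB Require Import structures.
Require Import Defs.
From mathcomp Require Import all_boot all_order all_algebra.
From mathcomp Require Import all_classical all_reals all_analysis.
From mathcomp Require Import measurable_realfun ring lra.

Set Implicit Arguments.
Unset Strict Implicit.
Unset Printing Implicit Defensive.

Import Order.TTheory GRing.Theory Num.Theory.
Import numFieldNormedType.Exports.

Local Open Scope classical_set_scope.
Local Open Scope ring_scope.


(** The test function is [u = phi \o rho], where [rho] is the defining
    function and [phi] a C^1 step from 0 at [e / 2] to 1 at [e], for a level [e]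
    of order [exp (- t)]. Three facts make it work; [gbar] is the compactified
    metric and [N] the square of the [gbar]-norm of [d rho].

    First, the ball of radius [t] lies in [rho >= e]. Since [gbar] is of class
    C^2 and [N = 1] on the boundary, [N <= 1 + C * rho] everywhere
    ([chart_bound], [finite_chart_cover], [grad_rho_le]). The complete metric is
    [rho ^- 2] times [gbar], so a function [phi \o rho] has slope at most
    [|phi' rho| * rho * sqrt (1 + C * rho)] along curves ([arc_length_ge],
    [geodist_ge]). For [phi s = ln s - ln (1 + C * s)] this is at most 1: that
    function of [rho] is 1-Lipschitz, and it differs from [ln rho] by a bounded
    amount, so [rho] decays at most like [exp (- t)] at distance [t].

    Second, by the same slope estimate the step function [u] is Lipschitz with a
    constant independent of [e], its gradient is bounded by that constant, and
    vanishes off the shell [e / 2 <= rho <= e].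

    Third, the shell has volume of order [e ^- n] ([volume_shell_le]): near the
    boundary [rho] is comparable to the first coordinate, so in each of finitely
    many charts the shell lies in a slab of thickness of order [e], where the
    volume density is [rho ^- n.+1 * sqrt (det gbar)], of order [e ^- n.+1].
    Hence the energy of [u] is of order [e ^- n], that is [exp (n * t)].

    Energy and volume are integrals of nonnegative functions, that is, suprema
    over simple functions; they are bounded from above through a bound on the
    integrand and the outer measure of its support ([integral_le_support]). In
    charts the boundary hyperplane of the
    half-space is called the wall. *)


(** * Functions with continuous partial derivatives *)

Section BigCvg.
Context {R : realType} {T I : Type} {F : set_system T} {FF : Filter F}.
Implicit Types (f : I -> T -> R) (a : I -> R).

Lemma cvg_sumR (r : seq I) (P : pred I) f a :
  (forall i, P i -> f i x @[x --> F] --> a i) ->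
  (\sum_(i <- r | P i) f i x) @[x --> F] --> \sum_(i <- r | P i) a i.
Proof. by apply: cvg_big; exact: add_continuous. Qed.

End BigCvg.

Section RowVectors.
Context {R : realType} {n : nat}.
Local Notation E := 'rV[R]_n.+1.
Local Notation e_ j := (delta_mx ord0 j : E).
Implicit Types (f : E -> R) (u v w : E).

Lemma coord_le_norm v j : `|v ord0 j| <= `|v|.
Proof.
rewrite [leRHS]/Num.Def.normr/= mx_normrE.
exact: (le_bigmax _ _ (ord0, j)).
Qed.

Lemma norm_le_coord v (r : R) :
  0 <= r -> (forall j, `|v ord0 j| <= r) -> `|v| <= r.
Proof.
move=> r0 vr; rewrite [leLHS]/Num.Def.normr/= mx_normrE.
by apply: bigmax_le => // -[i j] _ /=; rewrite (ord1 i).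
Qed.

Lemma growth_rate_line f u j (s : R) :
  (fun h : R => h^-1 *: (((fun s : R => f (s *: e_ j + u)) \o shift s) (h *: 1)
     - f (s *: e_ j + u))) =
  (fun h : R => h^-1 *: ((f \o shift (s *: e_ j + u)) (h *: e_ j)
     - f (s *: e_ j + u))).
Proof.
apply/funext => h /=; congr (_ *: (f _ - _)).
by rewrite [h *: 1]mulr1 scalerDl addrA.
Qed.

Lemma derive_line f u j (s : R) :
  'D_1 (fun s : R => f (s *: e_ j + u)) s = 'D_(e_ j) f (s *: e_ j + u).
Proof. by rewrite /derive growth_rate_line. Qed.

Lemma is_derive_line f u j (s : R) :
  derivable f (s *: e_ j + u) (e_ j) ->
  is_derive s 1 (fun s => f (s *: e_ j + u)) ('D_(e_ j) f (s *: e_ j + u)).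
Proof.
move=> df; split; last exact: derive_line.
rewrite /derivable growth_rate_line; exact: df.
Qed.

Lemma mean_value_line f u j (a : R) :
  (forall s, `|s| <= `|a| -> derivable f (s *: e_ j + u) (e_ j)) ->
  exists2 s, `|s| <= `|a| &
    f (a *: e_ j + u) - f u = a * 'D_(e_ j) f (s *: e_ j + u).
Proof.
move=> df.
have sa (s : R) : 0 <= s <= 1 -> `|s * a| <= `|a|.
  by move=> /andP[s0 s1]; rewrite normrM ger0_norm// ler_piMl.
have dg (s : R) : 0 <= s <= 1 -> is_derive s 1 (fun s => f ((s * a) *: e_ j + u))
    (a * 'D_(e_ j) f ((s * a) *: e_ j + u)).
  move=> s01.
  have H1 := is_derive_line (df _ (sa _ s01)).
  have H2 : is_derive s 1 (fun s : R => s * a) a.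
    by apply: is_derive_eq; rewrite scaler0 add0r [_ *: _]mulr1.
  rewrite mulrC.
  exact: (@is_derive1_comp _ (fun s => f (s *: e_ j + u)) (fun s => s * a)).
have [] := @MVT R (fun s => f ((s * a) *: e_ j + u))
  (fun s => a * 'D_(e_ j) f ((s * a) *: e_ j + u)) 0 1 ltr01.
- by move=> s; rewrite in_itv/= => /andP[s0 s1]; apply: dg; rewrite !ltW.
- apply: derivable_within_continuous => s; rewrite in_itv/= => s01.
  by have [] := dg s s01.
- move=> s; rewrite in_itv/= => /andP[s0 s1].
  rewrite subr0 mulr1 mul1r mul0r scale0r add0r => fE.
  by exists (s * a) => //; apply: sa; rewrite !ltW.
Qed.

(** The segment from [v] to [v + h] is replaced by a staircase along the
    coordinate axes, on each step of which the mean value theorem applies. *)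
Lemma differentiable_partial f v :
  (\forall u \near v, forall j, derivable f u (e_ j)) ->
  (forall j, {for v, continuous (fun u => 'D_(e_ j) f u)}) ->
  differentiable f v /\
  (forall h, 'd f v h = \sum_j h ord0 j * 'D_(e_ j) f v).
Proof.
move=> df cf.
pose L (h : E) : R := \sum_j h ord0 j * 'D_(e_ j) f v.
have Ladd : linear L.
  move=> k x y; rewrite /L scaler_sumr -big_split/=; apply: eq_bigr => j _.
  by rewrite !mxE mulrDl scalerAl.
pose LM := GRing.isLinear.Build _ _ _ _ L Ladd.
pose Ll : {linear E -> R} := HB.pack L LM.
have Lcont : continuous (Ll : E -> R).
  move=> x; apply: (@cvg_sumR _ _ _ (nbhs x) _) => j _.
  by apply: cvgMl; exact: coord_continuous.
have Lo : f \o shift v = cst (f v) + (Ll : E -> R) +o_ (0 : E) id.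
  apply/eqaddoP => e e0.
  have e'0 : 0 < e / n.+1%:R by rewrite divr_gt0.
  have : \forall u \near v, forall j, derivable f u (e_ j) /\
      `|'D_(e_ j) f v - 'D_(e_ j) f u| <= e / n.+1%:R.
    apply: (@filter_forall _ _ (fun j u => derivable f u (e_ j) /\
      `|'D_(e_ j) f v - 'D_(e_ j) f u| <= e / n.+1%:R) (nbhs v) _) => j.
    near=> u; split; first exact: (near df u).
    near: u; have /cvgrPdist_le := cf j; exact.
  move=> /nbhs_ballP[r /= r0 rP]; near=> h.
  have hr : `|h| < r.
    near: h; apply/nbhs_ballP; exists r => //= x.
    by rewrite -ball_normE/= sub0r normrN.
  pose p k : E := v + \sum_(j < n.+1 | (j < k)%N) h ord0 j *: e_ j.
  have pS (k : 'I_n.+1) : p k.+1 = h ord0 k *: e_ k + p k.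
    rewrite /p (bigD1 k) ?leqnn//= addrCA; congr (_ + (_ + _)).
    by apply: eq_bigl => j; rewrite ltnS ltn_neqAle andbC.
  have p0 : p 0%N = v by rewrite /p big_pred0_eq addr0.
  have pn : p n.+1 = h + v.
    rewrite /p addrC; congr (_ + _); rewrite [RHS]row_sum_delta.
    by apply: eq_bigl => j; rewrite ltn_ord.
  have pball (k : 'I_n.+1) (s : R) : `|s| <= `|h ord0 k| ->
      ball v r (s *: e_ k + p k).
    move=> sh; rewrite -ball_normE/= /p (_ : _ - _ =
      - (s *: e_ k + \sum_(j < n.+1 | (j < k)%N) h ord0 j *: e_ j)); last first.
      by rewrite addrCA opprD addNKr.
    rewrite normrN; apply: le_lt_trans hr; apply: norm_le_coord => // l.
    rewrite !mxE summxE /=.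
    have [->|lk] := eqVneq l k.
      rewrite mulr1 big1 ?addr0; first exact: (le_trans sh (coord_le_norm _ _)).
      move=> j jk; rewrite !mxE/= (_ : (k == j) = false) ?mulr0//.
      by apply/negbTE; rewrite -val_eqE /= neq_ltn jk orbT.
    rewrite mulr0 add0r.
    have [ll|ll] := ltnP l k.
      rewrite (bigD1 l)//= !mxE !eqxx mulr1 big1 ?addr0 ?coord_le_norm//.
      by move=> j /andP[_ jl]; rewrite !mxE eq_sym (negbTE jl) mulr0.
    rewrite big1 ?normr0// => j jk; rewrite !mxE/= (_ : (l == j) = false) ?mulr0//.
    by apply/negbTE; rewrite -val_eqE /= neq_ltn (leq_trans jk ll) orbT.
  rewrite !fctE /= /L.
  have -> : f (h + v) - (f v + \sum_j h ord0 j * 'D_(e_ j) f v) =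
     \sum_(k < n.+1) (f (p k.+1) - f (p k) - h ord0 k * 'D_(e_ k) f v).
    rewrite [RHS]big_split/= sumrN opprD addrA; congr (_ - _).
    rewrite -(big_mkord xpredT (fun k => f (p k.+1) - f (p k))).
    by rewrite telescope_sumr// pn p0.
  apply: le_trans (ler_norm_sum _ _ _) _.
  apply: (@le_trans _ _ (\sum_(k < n.+1) (e / n.+1%:R) * `|h|)); last first.
    by rewrite sumr_const card_ord -[leLHS]mulr_natl mulrA mulrC [_ * (e / _)]mulrC divfK// mulrC.
  apply: ler_sum => k _.
  have [|s sh] := @mean_value_line f (p k) k (h ord0 k).
    by move=> s /pball/rP/(_ k)[].
  rewrite -pS => ->; rewrite -mulrBr normrM mulrC distrC ler_pM//.
    exact: (rP _ (pball _ _ sh) k).2.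
  exact: coord_le_norm.
have dE : 'd f v = Ll :> (E -> R) by apply: diff_unique.
split; last by move=> h; rewrite dE.
by apply/diff_locallyP; rewrite dE.
Unshelve. all: by end_near. Qed.

End RowVectors.

Lemma continuous_comp_within {S T U : topologicalType} (D : set S) (V : set T)
    (c : S -> T) (f : T -> U) :
  {within D, continuous c} -> (forall t, D t -> V (c t)) ->
  {within V, continuous f} -> {within D, continuous (f \o c)}.
Proof.
move=> /subspace_continuousP cc DV /subspace_continuousP cf.
apply/subspace_continuousP => t Dt; apply: (cvg_comp _ _ _ (cf _ (DV _ Dt))).
move=> P /= VP; have := cc _ Dt _ VP; rewrite /within/= !nbhs_simpl/=.
by move=> H; near=> s => Ds; apply: (near H s) => //; exact: DV.
Unshelve. all: by end_near. Qed.

Lemma within_true {T : Type} (F : set_system T) (A : set T) : Filter F ->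
  F A -> within A F = F.
Proof.
move=> FF FA; apply/funext => P; apply/propext; split; rewrite /within/=.
  by move=> FP; apply: filterS2 FA FP => x Ax; exact.
by apply: filterS => x.
Qed.

Section PartialDerivatives.
Context {R : realType} {n : nat}.
Local Notation E := 'rV[R]_n.+1.
Local Notation e_ j := (delta_mx ord0 j : E).
Implicit Types (V : set E) (f : E -> R) (u v w : E).

Lemma Ck_continuous k V f : Ck k V f -> {within V, continuous f}.
Proof. by case: k => [|k] []. Qed.

Lemma CkW k V f : Ck k.+1 V f -> Ck k V f.
Proof.
elim: k f => [|k IH] f [cf df]; split => // j.
by have [dj /IH] := df j.
Qed.

(** Away from the wall all small increments stay in [V], so the restricted
    filter is the usual punctured neighbourhood filter and [pder] is an ordinary
    directional derivative. *)
Lemma pder_filterE V j v : nbhs v V -> pder_filter V j v = 0^'.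
Proof.
move=> Vv; apply: within_true.
suff Vh : \forall h \near (0 : R), V (v + h *: e_ j) by exact: nbhs_dnbhs.
have : (fun h : R => v + h *: e_ j) @ 0 --> v.
  have : (fun h : R => v + h *: e_ j) @ 0 --> v + 0 *: e_ j.
    by apply: cvgD; [exact: cvg_cst | apply: cvgZr_tmp].
  by rewrite scale0r addr0.
by move=> /(_ V Vv).
Qed.

Lemma diff_quotE j f v :
  diff_quot j f v = fun h => h^-1 *: ((f \o shift v) (h *: e_ j) - f v).
Proof. apply/funext => h; rewrite /diff_quot/=.
by rewrite (addrC v). Qed.

Lemma pder_interior V j f v : nbhs v V -> pder V j f v = 'D_(e_ j) f v.
Proof. by move=> Vv; rewrite /pder pder_filterE// diff_quotE. Qed.

Lemma Ck1_derivable V j f v : nbhs v V -> Ck 1 V f -> derivable f v (e_ j).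
Proof.
move=> Vv [_ /(_ j)[dj _]].
rewrite /derivable -diff_quotE -(pder_filterE j Vv).
exact: (dj v (nbhs_singleton Vv)).
Qed.

Lemma within_continuous_at V f v :
  nbhs v V -> {within V, continuous f} -> {for v, continuous f}.
Proof.
move=> Vv /subspace_continuousP /(_ v (nbhs_singleton Vv)).
by rewrite within_true.
Qed.

Lemma Ck1_differentiable V f v : nbhs v V -> Ck 1 V f ->
  differentiable f v /\
  forall h, 'd f v h = \sum_j h ord0 j * pder V j f v.
Proof.
move=> Vv cf.
have Vn : \forall u \near v, nbhs u V by exact: nbhs_interior.
have [||df dE] := @differentiable_partial R n f v.
- by near=> u => j; apply: (@Ck1_derivable V) => //; exact: (near Vn u).
- move=> j; rewrite /prop_for /continuous_at -(@pder_interior V)//.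
  have [_ /(_ j)[_ [/(within_continuous_at Vv) + _]]] := cf.
  move=> cp; apply: cvg_trans cp; apply: (@near_eq_cvg _ _ (nbhs v) _).
  near=> u; rewrite (@pder_interior V)//.
  exact: (near Vn u).
split=> // h; rewrite dE; apply: eq_bigr => j _.
by rewrite (@pder_interior V).
Unshelve. all: by end_near. Qed.

Lemma nbhs_half_space v : 0 < v ord0 ord0 -> nbhs v half_space.
Proof.
move=> v0; have := @coord_continuous R 1 n.+1 ord0 ord0 v.
rewrite /continuous_at => /(_ _ (lt_nbhsr v0)) H.
by near=> x; rewrite /half_space/=; apply: ltW; near: x; exact: H.
Unshelve. all: by end_near. Qed.

(** * Behaviour at the wall *)

Definition proj_wall v : E := v - v ord0 ord0 *: e_ ord0.

Lemma proj_wall0 v : proj_wall v ord0 ord0 = 0.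
Proof. by rewrite !mxE eqxx mulr1 subrr. Qed.

Lemma proj_wall_id v : v ord0 ord0 = 0 -> proj_wall v = v.
Proof. by move=> v0; rewrite /proj_wall v0 scale0r subr0. Qed.

Lemma proj_wallK v : v ord0 ord0 *: e_ ord0 + proj_wall v = v.
Proof. by rewrite addrC subrK. Qed.

Lemma coord_line_wall v s : (s *: e_ ord0 + proj_wall v) ord0 ord0 = s.
Proof. by rewrite mxE proj_wall0 !mxE eqxx mulr1 addr0. Qed.

Lemma line_wall_dist v w (s : R) : w ord0 ord0 = 0 ->
  0 <= s <= v ord0 ord0 -> `|s *: e_ ord0 + proj_wall v - w| <= `|v - w|.
Proof.
move=> w0 /andP[s0 sv]; apply: norm_le_coord => // j.
have [->|j0] := eqVneq j ord0.
  rewrite mxE coord_line_wall mxE w0 oppr0 addr0 ger0_norm//.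
  apply: le_trans (coord_le_norm _ ord0); rewrite !mxE w0 oppr0 addr0.
  by rewrite (le_trans sv)// ler_norm.
apply: le_trans (coord_le_norm _ j); rewrite !mxE (negbTE j0).
by rewrite andbF !mulr0 subr0 add0r.
Qed.

(** The mean value theorem on a segment normal to the wall: it starts on the
    wall and then stays in the interior, so only the continuity of [f] up to
    the wall matters there. The predicate [P] localizes the intermediate value
    of the derivative. *)
Lemma mean_value_wall (O : set E) f w (P : set R) :
  open O -> (O `&` half_space) w -> w ord0 ord0 = 0 ->
  Ck 1 (O `&` half_space) f ->
  (\forall u \near within (O `&` half_space) (nbhs w),
    P (pder (O `&` half_space) ord0 f u)) ->
  \forall v \near within (O `&` half_space) (nbhs w),
    (O `&` half_space) (proj_wall v) /\
    exists2 d, P d & f v - f (proj_wall v) = v ord0 ord0 * d.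
Proof.
set V := O `&` half_space => oO [Ow _] w0 cf nP.
have {}nP : \forall u \near w, V u -> P (pder V ord0 f u) by exact: nP.
have nO : nbhs w O by exact: open_nbhs_nbhs.
suff : \forall v \near w, V v -> V (proj_wall v) /\
    exists2 d, P d & f v - f (proj_wall v) = v ord0 ord0 * d by exact.
have /nbhs_ballP[r /= r0 rOP] :
  \forall u \near w, O u /\ (V u -> P (pder V ord0 f u)) by exact: filterI.
apply/nbhs_ballP; exists r => // v.
rewrite -ball_normE/= distrC => vw [_ hv].
have lineV s : 0 <= s <= v ord0 ord0 -> let u := s *: e_ ord0 + proj_wall v in
    V u /\ (V u -> P (pder V ord0 f u)).
  move=> /[dup] s0v /andP[s0 _] u.
  have [|Ou Pu] := rOP u.
    by rewrite -ball_normE/= distrC (le_lt_trans (line_wall_dist w0 _))//.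
  by split => //; split => //; rewrite /half_space/= coord_line_wall.
have [Vv _] : V v /\ (V v -> P (pder V ord0 f v)).
  by rewrite -(proj_wallK v); apply: lineV; rewrite lexx andbT.
have [Vp Pp] : V (proj_wall v) /\
    (V (proj_wall v) -> P (pder V ord0 f (proj_wall v))).
  by rewrite -[proj_wall v]add0r -(scale0r (e_ ord0)); apply: lineV; rewrite lexx.
split=> //.
have [v0|v0] := eqVneq (v ord0 ord0) 0.
  exists (pder V ord0 f (proj_wall v)); first exact: Pp.
  by rewrite proj_wall_id// subrr v0 mul0r.
have {}v0 : 0 < v ord0 ord0 by rewrite lt_neqAle eq_sym v0.
have nV s : 0 < s < v ord0 ord0 -> nbhs (s *: e_ ord0 + proj_wall v) V.
  move=> /andP[s0 sv]; apply: filterI.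
    apply: open_nbhs_nbhs; split=> //.
    by have [|[]] := lineV s; rewrite ?ltW.
  by apply: nbhs_half_space; rewrite coord_line_wall.
have [||s] := @MVT R (fun s => f (s *: e_ ord0 + proj_wall v))
  (fun s => 'D_(e_ ord0) f (s *: e_ ord0 + proj_wall v)) 0 _ v0.
- move=> s; rewrite in_itv/= => sv; apply: is_derive_line.
  by apply: (@Ck1_derivable V) => //; exact: nV.
- apply: (@continuous_comp_within _ _ _ _ V
    (fun s : R => s *: e_ ord0 + proj_wall v)) (Ck_continuous cf).
  + apply: continuous_subspaceT => s; apply: cvgD; last exact: cvg_cst.
    exact: cvgZr_tmp.
  + by move=> s; rewrite /= in_itv/= => /lineV[].
rewrite in_itv/= => sv; rewrite subr0 scale0r add0r proj_wallK => ->.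
exists (pder V ord0 f (s *: e_ ord0 + proj_wall v)).
  have [|Vs] := lineV s; last exact.
  by case/andP: sv => /ltW -> /ltW ->.
by rewrite mulrC (@pder_interior V)//; exact: nV.
Unshelve. all: by end_near. Qed.

Lemma proj_wall_dist v w : w ord0 ord0 = 0 -> 0 <= v ord0 ord0 ->
  `|proj_wall v - w| <= `|v - w|.
Proof.
move=> w0 v0; rewrite -[proj_wall v]add0r -(scale0r (e_ ord0)).
by apply: line_wall_dist; rewrite ?lexx.
Qed.

(** Allows estimates valid near [w] to be used at the foot of the normal segment
    as well. *)
Lemma cvg_proj_wall (O : set E) w : open O -> (O `&` half_space) w ->
  w ord0 ord0 = 0 ->
  proj_wall @ within (O `&` half_space) (nbhs w) -->
    within (O `&` half_space) (nbhs w).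
Proof.
set V := O `&` half_space => oO [Ow _] w0 Q VQ.
have {}VQ : \forall v \near w, V v -> Q v by exact: VQ.
suff : \forall v \near w, V v -> Q (proj_wall v) by exact.
have nO : nbhs w O by exact: open_nbhs_nbhs.
have /nbhs_ballP[r /= r0 rQ] :
  \forall v \near w, O v /\ (V v -> Q v) by exact: filterI.
apply/nbhs_ballP; exists r => // v.
rewrite -ball_normE/= distrC => vw [_ hv].
have [|Op] := rQ (proj_wall v); last first.
  by apply; split => //; rewrite /half_space/= proj_wall0.
by rewrite -ball_normE/= distrC (le_lt_trans (proj_wall_dist w0 hv)).
Qed.

End PartialDerivatives.

(** * Functions that are Lipschitz in the normal direction *)

Section NormallyLipschitz.
Context {R : realType} {T : Type} {F : set_system T} {FF : ProperFilter F}.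
Variables (proj : T -> T) (height : T -> R).
Hypothesis cvg_proj : proj @ F --> F.
Implicit Types (f g : T -> R) (l k : R).

(** Both [proj] and [height] are abstract, so that one set of closure lemmas
    serves at the wall, where [proj] is the projection to the wall and [height]
    the distance to it, and in the interior, where [proj = id] and [height = 0]
    reduce the condition to convergence. *)
Definition normally_lipschitz f l := f @ F --> l /\
  exists C, \forall v \near F, `|f v - f (proj v)| <= C * height v.

Let near_proj (P : set T) : F P -> \forall v \near F, P (proj v).
Proof. by move=> /cvg_proj. Qed.

Let bounded_near f l : f @ F --> l -> \forall v \near F, `|f v| <= `|l| + 1.
Proof.
move=> /cvgrPdist_le/(_ 1 ltr01) fl; near=> v.
have -> : f v = l - (l - f v) by rewrite subKr.
apply: le_trans (ler_normB _ _) _; rewrite lerD2l.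
exact: (near fl v).
Unshelve. all: by end_near. Qed.

Lemma normally_lipschitz_eq f g l : (\forall v \near F, f v = g v) ->
  normally_lipschitz f l -> normally_lipschitz g l.
Proof.
move=> fg [fl [C fC]]; split.
  by apply: cvg_trans fl; apply: near_eq_cvg; near=> v; exact: (near fg v).
have fgp := near_proj fg.
exists C; near=> v.
rewrite -(near fg v)// -[g (proj v)](near fgp v)//; exact: (near fC v).
Unshelve. all: by end_near. Qed.

Lemma normally_lipschitz_cst l : normally_lipschitz (fun=> l) l.
Proof.
split; first exact: cvg_cst.
by exists 0; near=> v; rewrite subrr normr0 mul0r.
Unshelve. all: by end_near. Qed.

Lemma normally_lipschitzD f g l k :
  normally_lipschitz f l -> normally_lipschitz g k ->
  normally_lipschitz (fun v => f v + g v) (l + k).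
Proof.
move=> [fl [C fC]] [gk [D gD]]; split; first exact: cvgD.
exists (C + D); near=> v; rewrite opprD addrACA mulrDl.
apply: le_trans (ler_normD _ _) _; apply: lerD.
  exact: (near fC v).
exact: (near gD v).
Unshelve. all: by end_near. Qed.

Lemma normally_lipschitzM f g l k :
  normally_lipschitz f l -> normally_lipschitz g k ->
  normally_lipschitz (fun v => f v * g v) (l * k).
Proof.
move=> [fl [C fC]] [gk [D gD]]; split; first exact: cvgM.
have fb := bounded_near fl.
have gb := near_proj (bounded_near gk).
exists ((`|l| + 1) * D + (`|k| + 1) * C); near=> v.
have -> : f v * g v - f (proj v) * g (proj v) =
  f v * (g v - g (proj v)) + g (proj v) * (f v - f (proj v)) by ring.
rewrite mulrDl -!mulrA; apply: le_trans (ler_normD _ _) _; rewrite !normrM.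
apply: lerD; apply: ler_pM => //.
- exact: (near fb v).
- exact: (near gD v).
- exact: (near gb v).
- exact: (near fC v).
Unshelve. all: by end_near. Qed.

Lemma normally_lipschitz_sum (I : Type) (r : seq I) (P : pred I) (f : I -> T -> R)
    (l : I -> R) :
  (forall i, P i -> normally_lipschitz (f i) (l i)) ->
  normally_lipschitz (fun v => \sum_(i <- r | P i) f i v) (\sum_(i <- r | P i) l i).
Proof.
move=> fl; elim: r => [|i r IH].
  rewrite big_nil; apply: normally_lipschitz_eq (normally_lipschitz_cst 0).
  by near=> v; rewrite big_nil.
rewrite big_cons; case: ifPn => Pi.
  apply: normally_lipschitz_eq (normally_lipschitzD (fl i Pi) IH).
  by near=> v; rewrite big_cons Pi.
apply: normally_lipschitz_eq IH.
by near=> v; rewrite big_cons (negbTE Pi).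
Unshelve. all: by end_near. Qed.

Lemma normally_lipschitz_prod (I : Type) (r : seq I) (P : pred I) (f : I -> T -> R)
    (l : I -> R) :
  (forall i, P i -> normally_lipschitz (f i) (l i)) ->
  normally_lipschitz (fun v => \prod_(i <- r | P i) f i v) (\prod_(i <- r | P i) l i).
Proof.
move=> fl; elim: r => [|i r IH].
  rewrite big_nil; apply: normally_lipschitz_eq (normally_lipschitz_cst 1).
  by near=> v; rewrite big_nil.
rewrite big_cons; case: ifPn => Pi.
  apply: normally_lipschitz_eq (normally_lipschitzM (fl i Pi) IH).
  by near=> v; rewrite big_cons Pi.
apply: normally_lipschitz_eq IH.
by near=> v; rewrite big_cons (negbTE Pi).
Unshelve. all: by end_near. Qed.

Lemma normally_lipschitzV f l : l != 0 ->
  normally_lipschitz f l -> normally_lipschitz (fun v => (f v)^-1) l^-1.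
Proof.
move=> l0 [fl [C fC]]; have fVl : (fun v => (f v)^-1) @ F --> l^-1 by exact: cvgV.
split=> //.
have fV := bounded_near fVl; have fVp := near_proj fV.
have f0 : \forall v \near F, f v != 0.
  by move/cvgrPdist_lt : fl => /(_ `|l|); rewrite normr_gt0 => /(_ l0);
    apply: filterS => v; apply: contraTneq => ->; rewrite subr0 ltxx.
have f0p := near_proj f0.
exists ((`|l^-1| + 1) * (`|l^-1| + 1) * C); near=> v.
have f0v : f v != 0 by exact: (near f0 v).
have f0pv : f (proj v) != 0 by exact: (near f0p v).
have -> : (f v)^-1 - (f (proj v))^-1 =
  - ((f v)^-1 * (f (proj v))^-1 * (f v - f (proj v))) by field; apply/andP.
rewrite normrN !normrM -[leRHS]mulrA; apply: ler_pM => //.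
  apply: ler_pM => //; first exact: (near fV v).
  exact: (near fVp v).
exact: (near fC v).
Unshelve. all: by end_near. Qed.

Lemma normally_lipschitz_det n (A : T -> 'M[R]_n) (L : 'M[R]_n) :
  (forall i j, normally_lipschitz (fun v => A v i j) (L i j)) ->
  normally_lipschitz (fun v => \det (A v)) (\det L).
Proof.
move=> AL; rewrite /determinant; apply: normally_lipschitz_sum => s _.
apply: normally_lipschitzM; first exact: normally_lipschitz_cst.
by apply: normally_lipschitz_prod => i _; exact: AL.
Qed.

(** Cramer's rule expresses the entries of the inverse through determinants, and
    the determinant of the limit does not vanish. *)
Lemma normally_lipschitz_invmx n (A : T -> 'M[R]_n) (L : 'M[R]_n) :
  L \in unitmx ->
  (forall i j, normally_lipschitz (fun v => A v i j) (L i j)) ->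
  forall i j, normally_lipschitz (fun v => invmx (A v) i j) (invmx L i j).
Proof.
move=> uL AL i j.
have dAL := normally_lipschitz_det AL.
have d0 : \det L != 0 by rewrite -unitfE.
have uA : \forall v \near F, A v \in unitmx.
  have /cvgrPdist_lt/(_ `|\det L|) := dAL.1; rewrite normr_gt0 => /(_ d0).
  apply: filterS => v; rewrite unitmxE unitfE.
  by apply: contraTneq => ->; rewrite subr0 ltxx.
have -> : invmx L i j = (\det L)^-1 * cofactor L j i.
  by rewrite /invmx uL !mxE.
apply: (@normally_lipschitz_eq (fun v => (\det (A v))^-1 * cofactor (A v) j i)).
  by near=> v; rewrite /invmx ifT ?mxE//; exact: (near uA v).
apply: normally_lipschitzM; first exact: normally_lipschitzV.
rewrite /cofactor; apply: normally_lipschitzM.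
  exact: normally_lipschitz_cst.
apply: normally_lipschitz_det => a b; rewrite !mxE.
by apply: normally_lipschitz_eq (AL _ _); near=> v; rewrite !mxE.
Unshelve. all: by end_near. Qed.

Lemma normally_lipschitz_covector n (G : T -> 'M[R]_n.+1) (w : T -> 'rV[R]_n.+1)
    (G0 : 'M[R]_n.+1) (w0 : 'rV[R]_n.+1) : G0 \in unitmx ->
  (forall i j, normally_lipschitz (fun v => G v i j) (G0 i j)) ->
  (forall j, normally_lipschitz (fun v => w v ord0 j) (w0 ord0 j)) ->
  normally_lipschitz (fun v => covector_norm2 (G v) (w v)) (covector_norm2 G0 w0).
Proof.
move=> uG GL wL; rewrite /covector_norm2 mxE.
apply: (@normally_lipschitz_eq (fun v =>
  \sum_j (\sum_k w v ord0 k * invmx (G v) k j) * w v ord0 j)).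
  by near=> v; rewrite mxE; apply: eq_bigr => j _; rewrite !mxE.
apply: normally_lipschitz_sum => j _; rewrite !mxE; apply: normally_lipschitzM => //.
apply: normally_lipschitz_sum => i _; apply: normally_lipschitzM => //.
exact: normally_lipschitz_invmx.
Unshelve. all: by end_near. Qed.

End NormallyLipschitz.

(** * Estimates in one chart *)

Section LocalBound.
Context {R : realType} {n : nat}.
Local Notation E := 'rV[R]_n.+1.
Local Notation e_ j := (delta_mx ord0 j : E).
Implicit Types (f : E -> R) (u v w : E).

Lemma posdef_unit (G : 'M[R]_n.+1) : posdef G -> G \in unitmx.
Proof.
move=> [_ G0]; rewrite -row_free_unit; apply: inj_row_free => v vG.
apply/eqP/negPn/negP => /G0; by rewrite vG mul0mx mxE ltxx.
Qed.

Lemma within_proper (V : set E) w : V w -> ProperFilter (within V (nbhs w)).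
Proof.
move=> Vw; apply: Build_ProperFilter_ex => P /nbhs_singleton Pw.
by exists w; exact: Pw.
Qed.

Lemma Ck_cvg k (V : set E) f w : Ck k V f -> V w ->
  f @ within V (nbhs w) --> f w.
Proof. by move=> /Ck_continuous/subspace_continuousP fV /fV. Qed.

(** The normal derivative is bounded near [w] because it is continuous up to the
    wall. *)
Lemma Ck1_normally_lipschitz (O : set E) f w :
  open O -> (O `&` half_space) w -> w ord0 ord0 = 0 ->
  Ck 1 (O `&` half_space) f ->
  normally_lipschitz (F := within (O `&` half_space) (nbhs w))
    proj_wall (fun v => v ord0 ord0) f (f w).
Proof.
set V := O `&` half_space => oO Vw w0 cf.
split; first exact: Ck_cvg cf Vw.
have [_ /(_ ord0)[_ cdf]] := cf.
have := Ck_cvg (k := 0) cdf Vw => /cvgrPdist_le/(_ 1 ltr01) db.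
exists (`|pder V ord0 f w| + 1).
have FF := within_proper Vw.
have H := mean_value_wall (P := fun d => `|d| <= `|pder V ord0 f w| + 1) oO Vw w0 cf.
have {H}/H H : \forall u \near within V (nbhs w),
    `|pder V ord0 f u| <= `|pder V ord0 f w| + 1.
  near=> u; have -> : pder V ord0 f u =
    pder V ord0 f w - (pder V ord0 f w - pder V ord0 f u) by rewrite subKr.
  apply: le_trans (ler_normB _ _) _; rewrite lerD2l; exact: (near db u).
near=> v.
have [_ [d dle ->]] : V (proj_wall v) /\
    exists2 d, `|d| <= `|pder V ord0 f w| + 1 &
      f v - f (proj_wall v) = v ord0 ord0 * d by exact: (near H v).
have v0 : half_space v by have [] : V v by near: v; exact: withinT.
by rewrite normrM mulrC ler_pM// ger0_norm.
Unshelve. all: by end_near. Qed.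

(** As [f] is constant on the wall its tangential derivatives vanish, so the
    nonzero differential is normal; were the normal derivative negative, the
    mean value theorem would make [f] negative just inside. *)
Lemma pder_wall_gt0 (O : set E) f w :
  open O -> (O `&` half_space) w -> w ord0 ord0 = 0 ->
  Ck 1 (O `&` half_space) f ->
  (forall v, (O `&` half_space) v -> 0 <= f v) ->
  (forall v, (O `&` half_space) v -> v ord0 ord0 = 0 -> f v = 0) ->
  grad (O `&` half_space) f w != 0 ->
  0 < pder (O `&` half_space) ord0 f w.
Proof.
set V := O `&` half_space => oO Vw w0 cf f_ge0 f_wall df0.
have FF := within_proper Vw.
have [Ow hw] := Vw.
have nO : nbhs w O by exact: open_nbhs_nbhs.
have line j : \forall h \near (0 : R), O (w + h *: e_ j).
  have : (fun h : R => w + h *: e_ j) @ 0 --> w + 0 *: e_ j.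
    by apply: cvgD; [exact: cvg_cst | apply: cvgZr_tmp].
  by rewrite scale0r addr0 => /(_ O nO).
have dtan j : j != ord0 -> pder V j f w = 0.
  move=> j0; have lineV : \forall h \near (0 : R),
      V (w + h *: e_ j) /\ f (w + h *: e_ j) = 0.
    near=> h; have hO : O (w + h *: e_ j) by near: h; exact: line.
    have h0 : (w + h *: e_ j) ord0 ord0 = 0.
      by rewrite !mxE w0 eq_sym (negbTE j0) andbF mulr0 addr0.
    have hV : V (w + h *: e_ j) by split => //; rewrite /half_space/= h0.
    by split => //; exact: f_wall.
  rewrite /pder /pder_filter within_true; last first.
    by apply: nbhs_dnbhs; apply: filterS lineV => h [].
  apply: cvg_lim => //; apply: (@cvg_near_cst _ _ 0).
  apply: nbhs_dnbhs; apply: filterS lineV => h [_].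
  by rewrite /diff_quot (f_wall w)// subr0 => ->; rewrite mulr0.
have d0 : pder V ord0 f w != 0.
  apply: contra df0 => /eqP d0; apply/eqP/rowP => j; rewrite !mxE.
  by have [->//|/dtan] := eqVneq j ord0.
rewrite lt_neqAle eq_sym d0 leNgt; apply/negP => d_lt0.
have [_ /(_ ord0)[_ cdf]] := cf.
have neg : \forall u \near within V (nbhs w), pder V ord0 f u < 0.
  exact: (Ck_cvg (k := 0) cdf Vw) (lt_nbhsl d_lt0).
have := mean_value_wall (P := fun d => d < 0) oO Vw w0 cf neg.
have : (fun h : R => w + h *: e_ ord0) @ 0^'+ --> within V (nbhs w).
  move=> Q VQ; have {}VQ : \forall v \near w, V v -> Q v by exact: VQ.
  have : (fun h : R => w + h *: e_ ord0) @ 0^'+ --> w + 0 *: e_ ord0.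
    apply: cvgD; [exact: cvg_cst | apply: cvgZr_tmp].
    exact: cvg_within.
  rewrite scale0r addr0 => /(_ _ VQ) {}VQ.
  have {}VQ : \forall h \near 0^'+, V (w + h *: e_ ord0) -> Q (w + h *: e_ ord0).
    exact: VQ.
  have lO : \forall h \near 0^'+, O (w + h *: e_ ord0) by exact: cvg_within (line ord0).
  suff : \forall h \near 0^'+, Q (w + h *: e_ ord0) by exact.
  near=> h; apply: (near VQ h) => //; split; first exact: (near lO h).
  by rewrite /half_space/= !mxE w0 eqxx add0r mulr1 ltW.
move=> cw /cw{cw} H.
have {}H : \forall h \near 0^'+, V (proj_wall (w + h *: e_ ord0)) /\
    exists2 d, d < 0 & f (w + h *: e_ ord0) - f (proj_wall (w + h *: e_ ord0)) =
     (w + h *: e_ ord0) ord0 ord0 * d by exact: H.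
near (0:R)^'+ => h.
have h0 : 0 < h by [].
have [Vp [d d_lt]] : V (proj_wall (w + h *: e_ ord0)) /\
    exists2 d, d < 0 & f (w + h *: e_ ord0) - f (proj_wall (w + h *: e_ ord0)) =
     (w + h *: e_ ord0) ord0 ord0 * d by exact: (near H h).
rewrite (f_wall _ Vp (proj_wall0 _)) subr0 !mxE w0 eqxx add0r mulr1 => fE.
have : f (w + h *: e_ ord0) < 0 by rewrite fE pmulr_rlt0.
rewrite ltNge f_ge0//; split; last first.
  by rewrite /half_space/= !mxE w0 eqxx add0r mulr1 ltW.
by near: h; exact: cvg_within (line ord0).
Unshelve. all: by end_near. Qed.

End LocalBound.

Section ChartBound.
Context {R : realType} {n : nat}.
Local Notation E := 'rV[R]_n.+1.
Implicit Types (u v w : E).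

(** The four estimates that enter the capacity bound, in one chart. On the
    wall they come from the gradient having norm exactly one there: its square
    is Lipschitz along the normal direction, and the height is comparable to
    [rho]. Away from the wall [rho] is bounded below and mere continuity
    suffices. *)
Lemma chart_bound (O : set E) (rho : E -> R) (G : E -> 'M[R]_n.+1) w :
  let V := O `&` half_space in
  open O -> V w ->
  (forall v, V v -> posdef (G v)) ->
  (forall a b, Ck 1 V (fun v => G v a b)) ->
  Ck 2 V rho ->
  (forall v, V v -> 0 <= rho v) ->
  (forall v, V v -> v ord0 ord0 = 0 ->
     rho v = 0 /\ covector_norm2 (G v) (grad V rho v) = 1) ->
  (w ord0 ord0 != 0 -> 0 < rho w) ->
  exists2 C : R, 0 < C & \forall v \near within V (nbhs w),
    [/\ covector_norm2 (G v) (grad V rho v) <= 1 + C * rho v,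
        v ord0 ord0 <= C * rho v, `|v| <= C & \det (G v) <= C].
Proof.
move=> V oO Vw Gpos cG crho rho_ge0 wall inner_gt0.
have FF := within_proper Vw.
have uG : G w \in unitmx by apply/posdef_unit/Gpos.
have crho1 : Ck 1 V rho by exact: CkW.
have cd j : Ck 1 V (pder V j rho) by have [_ /(_ j)[]] := crho.
pose N v := covector_norm2 (G v) (grad V rho v).
have Vn : \forall v \near within V (nbhs w), V v by exact: withinT.
have vb : \forall v \near within V (nbhs w), `|v| <= `|w| + 1.
  apply: cvg_within; have /cvgrPdist_le/(_ 1 ltr01) : id @ w --> w by exact: cvg_id.
  apply: filterS => v /= vw.
  have -> : v = w - (w - v) by rewrite subKr.
  by apply: le_trans (ler_normB _ _) _; rewrite lerD2l.
have bdd (f : E -> R) (l : R) : f @ within V (nbhs w) --> l ->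
    \forall v \near within V (nbhs w), f v <= `|l| + 1.
  move=> /cvgrPdist_le/(_ 1 ltr01); apply: filterS => v.
  by rewrite distrC => /(le_trans (ler_norm _)); have := ler_norm l; lra.
suff [C C0 [D D0 H]] : exists2 C : R, 0 < C & exists2 D : R, 0 < D &
    \forall v \near within V (nbhs w),
    [/\ N v <= 1 + C * rho v, v ord0 ord0 <= C * rho v & \det (G v) <= D].
  exists (C + D + `|w| + 1).
    by have := normr_ge0 w; lra.
  near=> v.
  have [NC vC dC] : [/\ N v <= 1 + C * rho v, v ord0 ord0 <= C * rho v &
    \det (G v) <= D] by exact: (near H v).
  have rv : 0 <= rho v by apply: rho_ge0; exact: (near Vn v).
  have w0 : 0 <= `|w| by [].
  have CC : C * rho v <= (C + D + `|w| + 1) * rho v.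
    by apply: ler_wpM2r => //; lra.
  split.
  - by apply: le_trans NC _; rewrite lerD2l.
  - exact: le_trans vC _.
  - have : `|v| <= `|w| + 1 by exact: (near vb v).
    by lra.
  - by lra.
(* At the wall, [N - 1] is at most a multiple of the height, hence of [rho]. *)
have [w0|w0] := eqVneq (w ord0 ord0) 0.
  have cp := cvg_proj_wall oO Vw w0.
  have h0 : \forall v \near within V (nbhs w), 0 <= (v : E) ord0 ord0.
    by apply: filterS Vn => v [].
  have NLG i j : normally_lipschitz (F := within V (nbhs w))
      proj_wall (fun v => v ord0 ord0) (fun v => G v i j) (G w i j).
    exact: (Ck1_normally_lipschitz oO Vw w0 (cG i j)).
  have NLN : normally_lipschitz (F := within V (nbhs w))
      proj_wall (fun v => v ord0 ord0) N (N w).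
    apply: normally_lipschitz_covector => // j; rewrite mxE.
    apply: normally_lipschitz_eq (Ck1_normally_lipschitz oO Vw w0 (cd j)) => //.
    by near=> v; rewrite mxE.
  have [dG _] := normally_lipschitz_det cp NLG.
  have a0 : 0 < pder V ord0 rho w.
    apply: pder_wall_gt0 => //; first by move=> v Vv /(wall _ Vv)[].
    have [_] := wall _ Vw w0; apply: contra_eq_neq => ->.
    by rewrite /covector_norm2 !mul0mx mxE eq_sym oner_eq0.
  set a := pder V ord0 rho w in a0.
  have [_ /(_ ord0)[_ cda]] := crho1.
  have low : \forall u \near within V (nbhs w), a / 2 <= pder V ord0 rho u.
    have a2 : a / 2 < a by rewrite ltr_pdivrMr// ltr_pMr// ltr1n.
    have H : \forall u \near within V (nbhs w), a / 2 < pder V ord0 rho u.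
      exact: (Ck_cvg (k := 0) cda Vw) (lt_nbhsr a2).
    by apply: filterS H => u; exact: ltW.
  have {}low := mean_value_wall (P := fun d => a / 2 <= d) oO Vw w0 crho1 low.
  have [_ [K NK]] := NLN.
  have rho_low : \forall v \near within V (nbhs w), (v : E) ord0 ord0 <= 2 / a * rho v.
    near=> v.
    have [Vp [d ad]] : V (proj_wall v) /\ exists2 d, a / 2 <= d &
      rho v - rho (proj_wall v) = v ord0 ord0 * d by exact: (near low v).
    have [-> _] := wall _ Vp (proj_wall0 v); rewrite subr0 => ->.
    have v0 : 0 <= v ord0 ord0 by exact: (near h0 v).
    rewrite mulrCA ler_peMr// mulrC -ler_pdivrMr ?divr_gt0//.
    by rewrite mul1r invf_div.
  exists (2 / a * (`|K| + 1)); first by rewrite mulr_gt0 ?divr_gt0// ltr_wpDl.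
  exists (`|\det (G w)| + 1); first by rewrite ltr_wpDl.
  near=> v.
  have v0 : 0 <= v ord0 ord0 by exact: (near h0 v).
  have vr : v ord0 ord0 <= 2 / a * rho v by exact: (near rho_low v).
  have r0 : 0 <= 2 / a * rho v by exact: le_trans vr.
  split.
  - have [Vp _] : V (proj_wall v) /\ exists2 d, a / 2 <= d &
      rho v - rho (proj_wall v) = v ord0 ord0 * d by exact: (near low v).
    have [_ Np] := wall _ Vp (proj_wall0 v).
    have : `|N v - N (proj_wall v)| <= K * v ord0 ord0 by exact: (near NK v).
    rewrite {2}/N Np => /(le_trans (ler_norm _)) NvK.
    rewrite -lerBlDl; apply: (le_trans NvK).
    have -> : 2 / a * (`|K| + 1) * rho v = (`|K| + 1) * (2 / a * rho v).
      by rewrite mulrAC mulrC.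
    apply: (@le_trans _ _ ((`|K| + 1) * v ord0 ord0)).
      by apply: ler_wpM2r => //; have := ler_norm K; lra.
    rewrite ler_wpM2l// ?addr_ge0//.
  - apply: (le_trans vr); rewrite [leRHS]mulrAC ler_peMr//.
    by have := normr_ge0 K; lra.
  - by near: v; exact: bdd.
(* Away from the wall, a large [C] makes [C * rho] exceed any local bound. *)
have rw := inner_gt0 w0.
have NL (f : E -> R) (l : R) : f @ within V (nbhs w) --> l -> normally_lipschitz
    (F := within V (nbhs w)) id (fun=> 0) f l.
  by move=> fl; split => //; exists 0; near=> v; rewrite /= subrr normr0 mulr0.
have NLG i j : normally_lipschitz (F := within V (nbhs w)) id (fun=> 0)
    (fun v => G v i j) (G w i j) by apply: NL; exact: (Ck_cvg (cG i j) Vw).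
have [Nw _] : normally_lipschitz (F := within V (nbhs w)) id (fun=> 0) N (N w).
  apply: (normally_lipschitz_covector _ uG NLG) => // j; apply: NL; rewrite mxE.
  apply: cvg_trans (Ck_cvg (cd j) Vw); apply: near_eq_cvg.
  by near=> v; rewrite mxE.
have [dG _] := normally_lipschitz_det (fun P => id) NLG.
have low : \forall u \near within V (nbhs w), rho w / 2 <= rho u.
  have a2 : rho w / 2 < rho w by rewrite ltr_pdivrMr// ltr_pMr// ltr1n.
  have H : \forall u \near within V (nbhs w), rho w / 2 < rho u.
    exact: (Ck_cvg crho Vw) (lt_nbhsr a2).
  by apply: filterS H => u; exact: ltW.
exists (2 / rho w * (`|N w| + `|w| + 1)).
  by rewrite mulr_gt0 ?divr_gt0// ltr_wpDl// addr_ge0.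
exists (`|\det (G w)| + 1); first by rewrite ltr_wpDl.
have Nb := bdd _ _ Nw.
near=> v.
have rv : `|N w| + `|w| + 1 <= 2 / rho w * (`|N w| + `|w| + 1) * rho v.
  rewrite mulrAC ler_peMl ?addr_ge0// mulrAC.
  by rewrite ler_pdivlMr// mul1r -ler_pdivrMl// mulrC; exact: (near low v).
split.
- apply: (@le_trans _ _ (`|N w| + 1)); first exact: (near Nb v).
  by have := normr_ge0 w; lra.
- apply: le_trans rv; apply: le_trans (ler_norm _) _.
  apply: le_trans (coord_le_norm _ _) _.
  have : `|v| <= `|w| + 1 by exact: (near vb v).
  by have := normr_ge0 (N w); lra.
- by near: v; exact: bdd.
Unshelve. all: by end_near. Qed.

End ChartBound.

(** * Norms of covectors and derivatives along curves *)

Section CauchySchwarz.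
Context {R : realType} {n : nat}.
Local Notation E := 'rV[R]_n.+1.
Implicit Types (G : 'M[R]_n.+1) (v w : E).

Lemma posdef_ge0 G v : posdef G -> 0 <= (v *m G *m v^T) ord0 ord0.
Proof.
move=> [_ G0]; have [->|/G0/ltW//] := eqVneq v 0.
by rewrite !mul0mx mxE.
Qed.

Lemma covector_norm2_ge0 G w : posdef G -> 0 <= covector_norm2 G w.
Proof.
move=> Gpos; have [GT _] := Gpos; have uG := posdef_unit Gpos.
rewrite /covector_norm2 (_ : w *m _ *m _ =
  (w *m invmx G) *m G *m (w *m invmx G)^T); first exact: posdef_ge0.
by rewrite mulmxKV// trmx_mul trmx_inv GT mulmxA.
Qed.

Lemma cauchy_schwarz_posdef G w v : posdef G ->
  (w *m v^T) ord0 ord0 ^+ 2 <=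
    covector_norm2 G w * (v *m G *m v^T) ord0 ord0.
Proof.
move=> Gpos; have [GT Gp] := Gpos; have uG := posdef_unit Gpos.
pose a := w *m invmx G.
pose q (x y : E) : R := (x *m G *m y^T) ord0 ord0.
have qC x y : q x y = q y x.
  rewrite /q -[in LHS](trmxK (x *m G *m y^T)) mxE.
  by rewrite !trmx_mul trmxK GT mulmxA.
have -> : (w *m v^T) ord0 ord0 = q a v by rewrite /q /a mulmxKV.
have -> : covector_norm2 G w = q a a.
  by rewrite /covector_norm2 /q /a mulmxKV// trmx_mul trmx_inv GT mulmxA.
rewrite -/(q v v).
have [->|v0] := eqVneq v 0.
  by rewrite /q trmx0 !mulmx0 mxE mulr0 expr0n.
have vv : 0 < q v v by exact: Gp.
have : 0 <= q (a - (q a v / q v v) *: v) (a - (q a v / q v v) *: v).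
  exact: posdef_ge0.
set s := q a v / q v v.
have -> : q (a - s *: v) (a - s *: v) = q a a - 2 * s * q a v + s ^+ 2 * q v v.
  have qD x y z : q (x + y) z = q x z + q y z by rewrite /q !mulmxDl mxE.
  have qZ k x z : q (k *: x) z = k * q x z by rewrite /q -!scalemxAl mxE.
  rewrite -scaleNr qD qZ ![q _ (_ + _)]qC !qD !qZ (qC v a).
  by ring.
have sv : s * q v v = q a v by rewrite /s divfK// gt_eqF.
have -> : q a a - 2 * s * q a v + s ^+ 2 * q v v = q a a - q a v ^+ 2 / q v v.
  by rewrite -sv; field; rewrite gt_eqF.
by rewrite subr_ge0 ler_pdivrMr.
Qed.

Lemma invmx_congruence (G J : 'M[R]_n.+1) : G \in unitmx ->
  J *m G *m J^T \in unitmx -> invmx G = J^T *m invmx (J *m G *m J^T) *m J.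
Proof.
move=> uG uJ.
have uJ1 : J \in unitmx by move: uJ; rewrite !unitmx_mul => /andP[/andP[]].
have : G *m (J^T *m invmx (J *m G *m J^T) *m J) = 1%:M.
  have -> : G *m (J^T *m invmx (J *m G *m J^T) *m J) =
      invmx J *m (J *m G *m J^T *m invmx (J *m G *m J^T)) *m J.
    by rewrite !mulmxA mulVmx// mul1mx.
  by rewrite mulmxV// mulmx1 mulVmx.
by move/(congr1 (mulmx (invmx G))); rewrite mulKmx// mulmx1.
Qed.

(** [J] plays the role of a Jacobian: components of covectors and of the metric
    change by [J] under a change of chart, and the norm does not. *)
Lemma covector_norm2_congruence (G J : 'M[R]_n.+1) w : G \in unitmx ->
  J *m G *m J^T \in unitmx ->
  covector_norm2 (J *m G *m J^T) (w *m J^T) = covector_norm2 G w.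
Proof.
move=> uG uJ; rewrite /covector_norm2 (invmx_congruence uG uJ).
by rewrite trmx_mul trmxK !mulmxA.
Qed.

Lemma covector_norm2Z G w (k : R) : k != 0 ->
  G \in unitmx -> covector_norm2 (k^-1 *: G) w = k * covector_norm2 G w.
Proof.
move=> k0 uG; rewrite /covector_norm2 invmxZ ?invrK//; last first.
  by rewrite unitmxZ// unitfE invr_eq0.
by rewrite -scalemxAr -scalemxAl mxE.
Qed.

End CauchySchwarz.

Section CurveDerivative.
Context {R : realType} {n : nat}.
Local Notation E := 'rV[R]_n.+1.

Lemma is_derive_curve (V : set E) (f : E -> R) (c : R -> E) (t : R) :
  nbhs (c t) V -> Ck 1 V f -> derivable c t 1 ->
  is_derive t 1 (f \o c) ((grad V f (c t) *m ('D_1 c t)^T) ord0 ord0).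
Proof.
move=> Vc cf dc.
have [df dE] := Ck1_differentiable Vc cf.
have dct : differentiable c t by apply/derivable1_diffP.
have dfc : differentiable (f \o c) t by exact: differentiable_comp.
split; first exact/derivable1_diffP.
rewrite deriveE// diff_comp//= dE mxE (deriveE _ dct).
by apply: eq_bigr => j _; rewrite !mxE mulrC.
Qed.

End CurveDerivative.

(** * Change of chart at inner points *)

Section ChartGeometry.
Context {R : realType} {n : nat} {M : ptopologicalType}.
Variable A : smooth_atlas R n M.
Local Notation E := 'rV[R]_n.+1.
Local Notation e_ j := (delta_mx ord0 j : E).
Local Notation dom := (@dom _ _ _ A).
Local Notation chart := (@chart _ _ _ A).
Local Notation chartV := (@chartV _ _ _ A).
Local Notation chart_idx := (chart_idx A).
Local Notation inner := (inner A).
Local Notation bdry := (bdry A).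
Implicit Types (i j : chart_idx) (x y : M) (f : M -> R) (g : metric_field A).

Lemma cvg_chart i x : dom i x ->
  chart i @ nbhs x --> within (chart i @` dom i) (nbhs (chart i x)).
Proof.
move=> dx; have nd : nbhs x (dom i).
  by apply: open_nbhs_nbhs; split=> //; exact: dom_open.
have /subspace_continuousP/(_ x dx) := @chart_continuous _ _ _ A i.
rewrite within_true// => cx P VP.
have {}VP : \forall v \near chart i x, (chart i @` dom i) v -> P v by exact: VP.
have {}cx := cx _ VP.
suff : \forall y \near x, P (chart i y) by exact.
have {}cx : \forall y \near x, (chart i @` dom i) (chart i y) -> P (chart i y) by exact: cx.
near=> y; apply: (near cx y) => //; exists y => //.
by near: y; exact: nd.
Unshelve. all: by end_near. Qed.

Lemma near_chart i x (P : set E) : dom i x ->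
  (\forall v \near within (chart i @` dom i) (nbhs (chart i x)), P v) ->
  \forall y \near x, dom i y /\ P (chart i y).
Proof.
move=> dx /(cvg_chart dx) nP.
have nd : nbhs x (dom i).
  by apply: open_nbhs_nbhs; split=> //; exact: dom_open.
exact: (filterI nd nP).
Qed.

(** A point at height zero in some chart is a boundary point by definition, so
    inner points are off the wall in every chart. *)
Lemma coord_inner_gt0 i x : dom i x -> inner x -> 0 < chart i x ord0 ord0.
Proof.
move=> dx ix; have [U oU UE] := chart_open i.
have [_ hx] : (U `&` half_space) (chart i x) by rewrite -UE; exists x.
by rewrite lt_neqAle hx andbT eq_sym; apply/eqP => x0; apply: ix; by exists i.
Qed.

Lemma nbhs_chart_dom i x : dom i x -> inner x ->
  nbhs (chart i x) (chart i @` dom i).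
Proof.
move=> dx ix; have [U oU UE] := chart_open i.
have [Ox _] : (U `&` half_space) (chart i x) by rewrite -UE; exists x.
rewrite UE; apply: filterI; first exact: open_nbhs_nbhs.
exact/nbhs_half_space/coord_inner_gt0.
Qed.

Lemma nbhs_chart_domI i j x : dom i x -> dom j x -> inner x ->
  nbhs (chart i x) (chart i @` (dom i `&` dom j)).
Proof.
move=> dx djx ix; have nV := nbhs_chart_dom dx ix.
have /subspace_continuousP/(_ (chart i x)) := @chartV_continuous _ _ _ A i.
rewrite within_true// => /(_ (ex_intro2 _ _ x dx erefl)).
move=> cV; have {}cV : chartV i @ nbhs (chart i x) --> x by rewrite -[X in _ --> X](chartK dx).
have nj : nbhs x (dom j) by apply: open_nbhs_nbhs; split=> //; exact: dom_open.
have {}cV : \forall v \near chart i x, dom j (chartV i v) by exact: cV.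
near=> v.
have [y dy yv] : (chart i @` dom i) v by near: v.
exists y => //; split => //.
by rewrite -(chartK dy) yv; near: v.
Unshelve. all: by end_near. Qed.

(** The chain rule is applied along the image in the chart [j] of a coordinate
    line of the chart [i], so that only curves, and never the transition map as a
    map between vector spaces, have to be differentiated. *)
Lemma dchart_transition f i j x : smooth A f -> dom i x -> dom j x -> inner x ->
  dchart i f x = dchart j f x *m (transition_jac i j x)^T.
Proof.
move=> sf dix djx ix.
have ni := nbhs_chart_dom dix ix; have nj := nbhs_chart_dom djx ix.
have nij := nbhs_chart_domI dix djx ix.
set v := chart i x; set W := chart i @` (dom i `&` dom j).
apply/rowP => a; rewrite [LHS]mxE.
pose tau (u : E) : E := chart j (chartV i u).
pose c (s : R) : E := tau (s *: e_ a + v).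
have c0 : c 0 = chart j x by rewrite /c /tau scale0r add0r chartK.
have dtau b : is_derive (0 : R) 1 (fun s => c s ord0 b)
    (transition_jac i j x a b).
  rewrite mxE (pder_interior _ _ nij).
  have := @is_derive_line R n (fun u => tau u ord0 b) v a 0.
  rewrite scale0r add0r; apply; apply: (@Ck1_derivable _ _ W) => //.
  exact: (transition_smooth i j 1).
have dc : derivable c 0 1.
  by apply/derivable_mxP => k b; rewrite (ord1 k); have [] := dtau b.
have cE : ('D_1 c 0)^T = (row a (transition_jac i j x))^T.
  apply/matrixP => b k; rewrite (ord1 k) mxE derive_mx// mxE mxE [RHS]mxE.
  by have [_ ->] := dtau b.
have H : is_derive (0 : R) 1 ((f \o chartV j) \o c)
    ((grad (chart j @` dom j) (f \o chartV j) (c 0) *m ('D_1 c 0)^T) ord0 ord0).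
  by apply: (is_derive_curve _ (sf j 1%N) dc); rewrite c0.
have H' : is_derive (0 : R) 1 (fun s => (f \o chartV i) (s *: e_ a + v))
    (pder (chart i @` dom i) a (f \o chartV i) v).
  rewrite (pder_interior _ _ ni).
  have := @is_derive_line R n (f \o chartV i) v a 0.
  rewrite scale0r add0r; apply.
  have sfi : Ck 1 (chart i @` dom i) (f \o chartV i) by exact (sf i 1%N).
  exact (Ck1_derivable (j := a) ni sfi).
have near0 : \forall s \near (0 : R), W (s *: e_ a + v).
  have : (fun s : R => s *: e_ a + v) @ 0 --> 0 *: e_ a + v.
    by apply: cvgD; [apply: cvgZr_tmp | exact: cvg_cst].
  by rewrite scale0r add0r => /(_ _ nij).
have HE : \forall s \near (0 : R), ((f \o chartV j) \o c) s =
    (f \o chartV i) (s *: e_ a + v).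
  apply: filterS near0 => s [y [diy djy] ys]; rewrite /c /tau /= -ys.
  by rewrite !chartK.
have [_ <-] := H'; rewrite -(near_eq_derive _ HE).
have [_ ->] := H; rewrite cE c0 /dchart.
by rewrite !mxE; apply: eq_bigr => b _; rewrite !mxE.
Qed.

Lemma covector_norm2_chart g f i j x : is_metric 2 setT g -> smooth A f ->
  dom i x -> dom j x -> inner x ->
  covector_norm2 (g i x) (dchart i f x) =
  covector_norm2 (g j x) (dchart j f x).
Proof.
move=> [gpos _ gtrans] sf dix djx ix.
have ui : g i x \in unitmx by apply/posdef_unit/gpos.
have uj : g j x \in unitmx by apply/posdef_unit/gpos.
rewrite (dchart_transition sf dix djx ix).
move: ui; rewrite (gtrans i j)// => ui.
exact: covector_norm2_congruence.
Qed.

End ChartGeometry.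

(** * Functions of the defining function along paths *)

Section PathLength.
Context {R : realType} {n : nat} {M : ptopologicalType}.
Variable A : smooth_atlas R n M.
Local Notation E := 'rV[R]_n.+1.
Local Notation dom := (@dom _ _ _ A).
Local Notation chart := (@chart _ _ _ A).
Local Notation chartV := (@chartV _ _ _ A).
Local Notation chart_idx := (chart_idx A).
Local Notation inner := (inner A).
Variables (rho : M -> R) (gplus gbar : metric_field A) (C : R).
Hypothesis rho_def : defining_function A rho.
Hypothesis gbar_metric : is_metric 2 setT gbar.
Hypothesis gplus_metric : is_metric 2 inner gplus.
Hypothesis conformal : forall i x, dom i x -> inner x ->
  gbar i x = rho x ^+ 2 *: gplus i x.
Hypothesis grad_rho_le : forall i x, dom i x -> inner x ->
  covector_norm2 (gbar i x) (dchart i rho x) <= 1 + C * rho x.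

Variables (phi dphi : R -> R) (K : R).
Hypothesis phi_derive : forall s : R, 0 < s -> is_derive s 1 phi (dphi s).
Hypothesis dphi_continuous : forall s : R, 0 < s -> {for s, continuous dphi}.
Hypothesis dphi_le : forall s : R, 0 < s -> `|dphi s| * s * Num.sqrt (1 + C * s) <= K.

(** The pointwise estimate: the conformal factor [rho ^+ 2] turns the length
    of a vector for the compactified metric into [rho] times its length for the
    complete one. *)
Lemma chain_speed_le i x (v : E) : dom i x -> inner x ->
  `|dphi (rho x) * (dchart i rho x *m v^T) ord0 ord0| <=
    K * Num.sqrt ((v *m gplus i x *m v^T) ord0 ord0).
Proof.
move=> dx ix; have [_ /(_ x ix) rx _ _] := rho_def.
have [gbar_pos _ _] := gbar_metric; have [gplus_pos _ _] := gplus_metric.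
have := cauchy_schwarz_posdef (dchart i rho x) v (gbar_pos i x dx I).
pose q := (v *m gplus i x *m v^T) ord0 ord0; rewrite -/q.
have -> : (v *m gbar i x *m v^T) ord0 ord0 = rho x ^+ 2 * q.
  by rewrite (conformal dx ix) -scalemxAr -scalemxAl mxE.
set w := (_ *m v^T) ord0 ord0 => wq.
have q0 : 0 <= q by apply: posdef_ge0; exact: gplus_pos.
have {wq} wq : `|w| <= Num.sqrt (1 + C * rho x) * rho x * Num.sqrt q.
  rewrite -sqrtr_sqr.
  apply: (@le_trans _ _ (Num.sqrt ((1 + C * rho x) * (rho x ^+ 2 * q)))).
    apply: ler_wsqrtr; apply: (le_trans wq); apply: ler_wpM2r.
      by rewrite mulr_ge0// sqr_ge0.
    exact: grad_rho_le.
  rewrite sqrtrM; last first.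
    apply: le_trans (grad_rho_le dx ix); apply: covector_norm2_ge0.
    exact: gbar_pos.
  by rewrite sqrtrM ?sqr_ge0// sqrtr_sqr gtr0_norm// mulrA.
rewrite normrM; apply: le_trans (ler_wpM2l (normr_ge0 _) wq) _.
rewrite !mulrA; apply: ler_wpM2r; first exact: sqrtr_ge0.
by rewrite mulrAC; exact: dphi_le.
Qed.

(** The increment of [phi \o rho] along the arc is the integral of its derivative,
    which is bounded pointwise by [K] times the speed. *)
Lemma arc_length_ge i (c : R -> E) :
  (forall t, derivable c t 1) -> continuous ('D_1 c) ->
  (forall t, 0 <= t <= 1 -> (chart i @` (dom i `&` inner)) (c t)) ->
  `|phi (rho (chartV i (c 0))) - phi (rho (chartV i (c 1)))|
    <= K * arc_length gplus i c.
Proof.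
move=> dc cdc cV.
have [srho rho_gt0 _ _] := rho_def.
have [_ gplus_cont _] := gplus_metric.
have c01 t : 0 <= t <= 1 ->
    [/\ dom i (chartV i (c t)), inner (chartV i (c t)) &
      chart i (chartV i (c t)) = c t].
  by move=> /cV[x [dx ix] xE]; rewrite -xE chartK.
pose V := chart i @` dom i.
have cc : {within `[0, 1], continuous c}.
  apply: continuous_subspaceT => t.
  exact/differentiable_continuous/derivable1_diffP.
pose r t := rho (chartV i (c t)).
have rc : {within `[0, 1], continuous r}.
  apply: (@continuous_comp_within _ _ _ _ V c (rho \o chartV i)) => //.
    by move=> t; rewrite /= in_itv/= => /cV[x [dx _] <-]; exists x.
  exact: (Ck_continuous (srho i 0%N)).
have rpos t : 0 <= t <= 1 -> 0 < r t by move=> /c01[_ it _]; exact: rho_gt0.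
have comp_r (psi : R -> R) : (forall s : R, 0 < s -> {for s, continuous psi}) ->
    {within `[0, 1], continuous (psi \o r)}.
  move=> cpsi; apply: (@continuous_comp_within _ _ _ _ [set s : R | 0 < s] r psi rc).
    by move=> t; rewrite /= in_itv/=; exact: rpos.
  by apply: continuous_in_subspaceT => s; rewrite inE; exact: cpsi.
pose w t := grad V (rho \o chartV i) (c t).
pose D t := dphi (r t) * (w t *m ('D_1 c t)^T) ord0 ord0.
pose speed t :=
  Num.sqrt (('D_1 c t *m gplus i (chartV i (c t)) *m ('D_1 c t)^T) ord0 ord0).
have cdcj j t : ('D_1 c s ord0 j) @[s --> within `[0, 1] (nbhs t)] --> 'D_1 c t ord0 j.
  apply: cvg_within_filter; apply: (@cvg_comp _ _ _ ('D_1 c) (fun M => M ord0 j)).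
    exact: cdc.
  exact: coord_continuous.
pose quad t := \sum_a
    (\sum_b 'D_1 c t ord0 b * gplus i (chartV i (c t)) b a) * 'D_1 c t ord0 a.
have speedE : speed = Num.sqrt \o quad.
  apply/funext => t; rewrite /speed mxE; congr Num.sqrt.
  by apply: eq_bigr => a _; rewrite !mxE.
have DE : D = fun t => dphi (r t) *
    \sum_a pder V a (rho \o chartV i) (c t) * 'D_1 c t ord0 a.
  apply/funext => t; rewrite /D mxE; congr (_ * _).
  by apply: eq_bigr => a _; rewrite !mxE.
have gc b a : {within `[0, 1], continuous (fun t => gplus i (chartV i (c t)) b a)}.
  apply: (continuous_comp_within cc _ (Ck_continuous (gplus_cont i b a))).
  by move=> t; rewrite /= in_itv/=; exact: cV.
have pc a : {within `[0, 1], continuous (fun t => pder V a (rho \o chartV i) (c t))}.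
  have [_ /(_ a)[_ cpa]] := srho i 1%N.
  apply: (continuous_comp_within cc _ (Ck_continuous (k := 0) cpa)).
  by move=> t; rewrite /= in_itv/= => /cV[x [dx _] <-]; exists x.
have speedc : {within `[0, 1], continuous speed}.
  rewrite speedE; apply/subspace_continuousP => t t01.
  suff qc : quad @ within `[0, 1] (nbhs t) --> quad t.
    exact: (cvg_comp _ _ qc (@sqrt_continuous R _)).
  apply: (@cvg_sumR _ _ _ (within `[0, 1] (nbhs t)) _) => a _.
  apply: cvgM; last exact: cdcj.
  apply: (@cvg_sumR _ _ _ (within `[0, 1] (nbhs t)) _) => b _.
  apply: cvgM; first exact: cdcj.
  by have /subspace_continuousP := gc b a; exact.
have Dc : {within `[0, 1], continuous D}.
  rewrite DE; apply/subspace_continuousP => t t01; apply: cvgM.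
    by have /subspace_continuousP := comp_r _ dphi_continuous; exact.
  apply: (@cvg_sumR _ _ _ (within `[0, 1] (nbhs t)) _) => a _.
  apply: cvgM; last exact: cdcj.
  by have /subspace_continuousP := pc a; exact.
have dh (t : R) : 0 < t < 1 -> is_derive t 1 (phi \o r) (D t).
  move=> /andP[t0 t1]; have t01 : 0 <= t <= 1 by rewrite !ltW.
  have [dt it ct] := c01 _ t01.
  have H1 : is_derive (r t) 1 phi (dphi (r t)) by apply/phi_derive/rpos.
  have H2 : is_derive t 1 r ((w t *m ('D_1 c t)^T) ord0 ord0).
    apply: (is_derive_curve _ (srho i 1%N) (dc t)).
    by rewrite -ct; exact: nbhs_chart_dom.
  exact: is_derive1_comp.
have phic (s : R) : 0 < s -> {for s, continuous phi}.
  move=> s0; apply: differentiable_continuous; apply/derivable1_diffP.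
  by have [] := phi_derive s0.
have FTC := @continuous_FTC2 R D (phi \o r) 0 1 ltr01 Dc.
have {}FTC : \int[lebesgue_measure]_(t in `[0, 1]) D t = phi (r 1) - phi (r 0).
  rewrite /Rintegral FTC//.
    have /continuous_within_itvP[//|_ r0 r1] := comp_r _ phic.
    split => // t; rewrite in_itv/= => t01.
    by have [] := dh _ t01.
  move=> t; rewrite in_itv/= => t01; rewrite derive1E.
  by have [] := dh _ t01.
have int_cont (f : R -> R) : {within `[0, 1], continuous f} ->
    lebesgue_measure.-integrable `[0, 1] (EFin \o f).
  by move=> cf; apply: continuous_compact_integrable => //; exact: segment_compact.
have mI : measurable (`[0, 1] : set (measurableTypeR R)) by exact: measurable_itv.
rewrite distrC -[X in `|X|]FTC.
apply: le_trans (le_normr_Rintegral mI (int_cont _ Dc)) _.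
rewrite /arc_length -RintegralZl//; last exact: int_cont.
apply: le_Rintegral => //.
- apply: int_cont; apply/subspace_continuousP => t t01.
  by apply: cvg_norm; have /subspace_continuousP := Dc; exact.
- apply: int_cont; apply/subspace_continuousP => t t01.
  apply: cvgM; first exact: cvg_cst.
  by have /subspace_continuousP := speedc; exact.
- move=> t; rewrite /= in_itv/= => t01.
  have [dt it ct] := c01 _ t01.
  have := chain_speed_le ('D_1 c t) dt it.
  by rewrite /dchart ct.
Qed.

Lemma path_length_ge x y (l : R) : path_length gplus x y l -> inner y ->
  inner x /\ `|phi (rho x) - phi (rho y)| <= K * l.
Proof.
elim=> {x y l} [x ix|i c y l dc cdc cV _ IH iy].
  by rewrite subrr normr0 mulr0.
have [i1 H1] := IH iy.
split.
  by have [|x [dx ix] <-] := cV 0; rewrite ?lexx ?ler01// chartK.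
have := arc_length_ge dc cdc cV => H0.
rewrite -(subrKA (phi (rho (chartV i (c 1))))) mulrDr.
by apply: le_trans (ler_normD _ _) _; exact: lerD.
Qed.

(** Used twice: for a logarithmic [phi], to locate balls, and for a cutoff [phi],
    to see that the test function is Lipschitz. *)
Lemma geodist_ge x y : 0 < K -> inner y ->
  (`|phi (rho x) - phi (rho y)|%:E <= K%:E * geodist gplus x y)%E.
Proof.
move=> K0 iy; rewrite -lee_pdivrMl//.
apply: le_ereal_inf_tmp => _ [l xyl <-]; rewrite -EFinM lee_fin ler_pdivrMl//.
by have [] := path_length_ge xyl iy.
Qed.

End PathLength.

(** * Upper bounds for integrals and outer measures *)

Section OuterIntegral.
Import HBNNSimple.
Context {d} {T : measurableType d} {R : realType}.
Local Open Scope ereal_scope.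

(** The integral of a nonnegative function is a supremum over simple
    functions, so only measurable subsets of the support of the function
    contribute. *)
Lemma integral_le_support (mu : {measure set T -> \bar R}) (D S : set T)
    (f : T -> \bar R) (K : R) (b : \bar R) : (0 <= K)%R ->
  (forall x, D x -> 0 <= f x <= K%:E) ->
  (forall x, D x -> f x != 0 -> S x) ->
  (forall U, measurable U -> U `<=` S -> mu U <= b) ->
  \int[mu]_(x in D) f x <= K%:E * b.
Proof.
move=> K0 f0K fS mub; rewrite ge0_integralE; last by move=> x /f0K/andP[].
apply: ge_ereal_sup => _ [h hf <-].
pose U := (h : T -> R) @^-1` (~` [set 0%R]).
have mU : measurable U.
  by apply: measurable_sfunP; apply: measurableC; exact: measurable_set1.
have hU x : (h x <= K * \1_U x)%R.
  rewrite indicE; have [xU|xU] := boolP (x \in U); last first.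
    have -> : h x = 0%R by apply: contrapT => hx; move: xU; rewrite notin_setE.
    by rewrite mulr0.
  rewrite mulr1 -lee_fin; apply: (le_trans (hf x)); rewrite /patch.
  by case: ifPn => [|_]; [rewrite inE => /f0K/andP[] | rewrite lee_fin].
have US : U `<=` S.
  move=> x hx0; have hx : (0 < h x)%R.
    by rewrite lt_neqAle fun_ge0 andbT eq_sym; apply/eqP.
  have := hf x; rewrite /patch; case: ifPn => [|_]; last first.
    by rewrite lee_fin leNgt hx.
  rewrite inE => Dx hfx; apply: fS => //; rewrite gt_eqF//.
  by apply: lt_le_trans hfx; rewrite lte_fin.
rewrite -integralT_nnsfun.
apply: (@le_trans _ _ (\int[mu]_x (K%:E * (\1_U x)%:E))).
  apply: ge0_le_integral => //.
  - by move=> x _; rewrite lee_fin.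
  - by apply/measurable_EFinP; exact: measurable_funPT.
  - by apply: emeasurable_funM => //; apply/measurable_EFinP; exact: measurable_indic.
  - by move=> x _; rewrite -EFinM lee_fin.
rewrite ge0_integralZl//; last first.
  by apply/measurable_EFinP; exact: measurable_indic.
rewrite integral_indic// setIT; apply: lee_wpmul2l; first by rewrite lee_fin.
exact: mub.
Qed.

End OuterIntegral.

Section OuterMeasure.
Context {R : realType}.
Local Open Scope ereal_scope.

(** A measurable set is covered by itself, followed by empty sets. *)
Lemma mu_ext_le d (T : semiRingOfSetsType d) (mu : set T -> \bar R) (X : set T) :
  mu set0 = 0 -> measurable X -> mu_ext mu X <= mu X.
Proof.
move=> mu0 mX; apply: ereal_inf_lbound.
exists (fun k => if k is 0%N then X else set0).
  split; first by case.
  by move=> x Xx; exists 0%N.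
apply: lim_near_cst => //; near=> k.
rewrite big_ltn; last by near: k; exact: nbhs_infty_gt.
rewrite big_nat big1 ?adde0// => -[//|l] _.
exact: mu0.
Unshelve. all: by end_near. Qed.

Lemma outer_measure_seq_cover (T I : Type) (mu : {outer_measure set T -> \bar R})
    (s : seq I) (B : I -> set T) :
  mu (\big[setU/set0]_(i <- s) B i) <= \sum_(i <- s) mu (B i).
Proof.
elim: s => [|i s IH]; first by rewrite !big_nil outer_measure0.
rewrite !big_cons; apply: le_trans (outer_measureU2 _ _ _) _.
exact: leeD.
Qed.

End OuterMeasure.

Section LebesgueBox.
Context {R : realType} {n : nat}.
Local Notation E := 'rV[R]_n.+1.

Definition box (lo hi : E) : set E :=
  [set v | forall i, lo ord0 i <= v ord0 i <= hi ord0 i].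

Lemma closed_box (lo hi : E) : closed (box lo hi).
Proof.
have -> : box lo hi = \bigcap_(i in [set: 'I_n.+1])
    ((fun v : E => v ord0 i) @^-1` `[lo ord0 i, hi ord0 i]).
  apply/seteqP; split => v /= vb i; last by have := vb i I; rewrite /= in_itv.
  by move=> _; rewrite /= in_itv/=; exact: vb.
apply: closed_bigI => i _; apply: preimage_closed; last exact: itv_closed.
by move=> v _; exact: coord_continuous.
Qed.

Lemma lebesgue_box_le (lo hi : E) : (forall i, lo ord0 i <= hi ord0 i) ->
  (lebesgue_rV (box lo hi) <= (\prod_i (hi ord0 i - lo ord0 i))%:E)%E.
Proof.
move=> lohi; apply: (@le_trans _ _ (box_gauge (box lo hi))); last first.
  apply: ereal_inf_lbound; exists (lo, hi) => //.
apply: mu_ext_le; first exact: box_gauge0.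
rewrite -[box _ _]setCK; apply: measurableC; apply: sub_sigma_algebra.
by apply: closed_openC; exact: closed_box.
Qed.

End LebesgueBox.

(** * The cutoff function *)

Section Cutoff.
Context {R : realType}.
Implicit Types y s e : R.

Definition sqr_pos y : R := Num.max 0 y ^+ 2.

Lemma sqr_pos_le0 y : y <= 0 -> sqr_pos y = 0.
Proof. by move=> y0; rewrite /sqr_pos max_l// expr0n. Qed.

Lemma sqr_pos_ge0 y : 0 <= y -> sqr_pos y = y ^+ 2.
Proof. by move=> y0; rewrite /sqr_pos max_r. Qed.

Lemma is_derive_sqr_pos y : is_derive y 1 sqr_pos (2 * Num.max 0 y).
Proof.
have [y0|y0|->] := ltgtP y 0.
- apply: (@near_eq_is_derive _ _ _ (cst 0)).
    by near=> s; rewrite sqr_pos_le0// ltW//; near: s; exact: lt_nbhsl.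
  by rewrite mulr0; exact: is_derive_cst.
- apply: (@near_eq_is_derive _ _ _ (fun s => s ^+ 2)).
    by near=> s; rewrite sqr_pos_ge0// ltW//; near: s; exact: lt_nbhsr.
  by apply: is_derive_eq; rewrite [y%:A]mulr1 mulr_natl mulr2n.
rewrite mulr0.
have cm : (Num.max 0 h : R) @[h --> 0^'] --> (0 : R).
  rewrite -[X in _ --> X]maxxx; apply: cvg_within_filter.
  by apply: (@continuous_max R R); [exact: cvg_cst | exact: cvg_id].
have H : (fun h : R => h^-1 *: ((sqr_pos \o shift 0) (h *: 1) - sqr_pos 0))
    @ 0^' --> (0 : R).
  apply: cvg_trans cm; apply: near_eq_cvg; near=> h.
  have h0 : h != 0 by near: h; exact: nbhs_dnbhs_neq.
  rewrite /= addr0 [h *: 1]mulr1 (sqr_pos_le0 (lexx 0)) subr0.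
  rewrite /sqr_pos; have [hp|hn] := leP 0 h.
    by rewrite expr2 /GRing.scale/= mulKf.
  by rewrite expr0n scaler0.
by split; [apply/cvg_ex; exists 0 | exact: cvg_lim].
Unshelve. all: by end_near. Qed.

(** A C^1 step function: the composite [1 - (1 - y^2)^2] of the squared
    positive part with itself climbs from 0 to 1 on [0, 1] and is flat to first
    order at both ends. *)
Lemma cutoff_exists e : 0 < e -> exists phi dphi : R -> R,
  [/\ forall s, is_derive s 1 phi (dphi s), continuous dphi,
      forall s, s <= e / 2 -> phi s = 0,
      forall s, e <= s -> phi s = 1
    & forall s, `|dphi s| <= 8 / e /\ (dphi s != 0 -> e / 2 <= s <= e)].
Proof.
move=> e0; pose y s := 2 / e * s - 1.
pose phi s := 1 - sqr_pos (1 - sqr_pos (y s)).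
pose dphi s :=
  2 * Num.max 0 (1 - sqr_pos (y s)) * (2 * Num.max 0 (y s) * (2 / e)).
have ylt0 s : s <= e / 2 -> y s <= 0.
  move=> se; rewrite subr_le0.
  have e2 : 2 / e * (e / 2) = 1 by rewrite mulrA divfK ?gt_eqF// divff.
  by rewrite -[leRHS]e2 ler_wpM2l// divr_ge0// ltW.
have ygt1 s : e <= s -> 1 <= y s.
  move=> es; have : 2 / e * e <= 2 / e * s by rewrite ler_wpM2l// divr_ge0// ltW.
  by rewrite divfK ?gt_eqF// /y; lra.
have dy s : is_derive s 1 y (2 / e).
  rewrite /y; apply: is_derive_eq.
  by rewrite subr0 [_ *: _]mulr1.
exists phi, dphi; split.
- move=> s.
  have H1 : is_derive s 1 (sqr_pos \o y) (2 * Num.max 0 (y s) * (2 / e)).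
    by apply: is_derive1_comp; exact: is_derive_sqr_pos.
  have H2 : is_derive s 1 (cst 1 - (sqr_pos \o y)) (- (2 * Num.max 0 (y s) * (2 / e))).
    by apply: is_derive_eq; rewrite sub0r.
  have H3 : is_derive s 1 (sqr_pos \o (cst 1 - (sqr_pos \o y)))
     (2 * Num.max 0 (1 - sqr_pos (y s)) * - (2 * Num.max 0 (y s) * (2 / e))).
    by apply: is_derive1_comp; exact: is_derive_sqr_pos.
  have -> : phi = cst 1 - (sqr_pos \o (cst 1 - (sqr_pos \o y))) by apply/funext.
  by apply: is_derive_eq; rewrite sub0r mulrN opprK.
- have cmax (f : R -> R) : continuous f -> continuous (fun s => 2 * Num.max 0 (f s)).
    move=> cf s; apply: cvgM; first exact: cvg_cst.
    by apply: (@continuous_max R R); [exact: cvg_cst | exact: cf].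
  have cy : continuous y.
    by move=> s; apply: cvgB; [apply: cvgM; [exact: cvg_cst | exact: cvg_id] | exact: cvg_cst].
  have cq : continuous (sqr_pos \o y).
    move=> s; apply: continuous_comp; first exact: cy.
    apply: differentiable_continuous; apply/derivable1_diffP.
    by have [] := is_derive_sqr_pos (y s).
  have c1 : continuous (fun s => 2 * Num.max 0 (1 - sqr_pos (y s))).
    by apply: (cmax (fun s => 1 - sqr_pos (y s))) => t;
      apply: cvgB; [exact: cvg_cst | exact: cq].
  move=> s; apply: cvgM; first exact: c1.
  by apply: cvgM; [exact: (cmax y cy s) | exact: cvg_cst].
- move=> s /ylt0 ys; rewrite /phi (sqr_pos_le0 ys) subr0 sqr_pos_ge0//.
  by rewrite expr1n subrr.
- move=> s /ygt1 ys; rewrite /phi sqr_pos_le0 ?subr0// subr_le0.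
  rewrite sqr_pos_ge0 ?(le_trans _ ys)//; exact: exprn_ege1.
move=> s; have [ys|ys] := leP (y s) 0.
  rewrite /dphi [Num.max 0 (y s)]max_l// !(mulr0, mul0r) normr0 eqxx; split => //.
  by rewrite divr_ge0// ltW.
have [ys1|ys1] := leP 1 (y s).
  rewrite /dphi [Num.max 0 (1 - _)]max_l ?(mulr0, mul0r) ?normr0 ?eqxx//.
    by split => //; rewrite divr_ge0// ltW.
  by rewrite subr_le0 sqr_pos_ge0 ?(ltW ys)//; exact: exprn_ege1.
split; last first.
  move=> _; apply/andP; split; apply/ltW; rewrite ltNge; apply/negP.
    by move/ylt0; rewrite leNgt ys.
  by move/ygt1; rewrite leNgt ys1.
have y2 : 0 <= 1 - sqr_pos (y s) <= 1.
  rewrite sqr_pos_ge0 ?(ltW ys)// subr_ge0 gerBl sqr_ge0 andbT.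
  by rewrite exprn_ile1// ltW.
rewrite /dphi (max_r (ltW ys)) max_r; last by case/andP: y2.
case/andP: y2 => z0 z1; set z := 1 - _ in z0 z1 *.
have [e_ge0 y_ge0] := (ltW e0, ltW ys).
rewrite ger0_norm; last by rewrite !mulr_ge0// invr_ge0.
have -> : 2 * z * (2 * y s * (2 / e)) = z * y s * (8 / e) by field; rewrite gt_eqF.
by rewrite ler_piMl ?divr_ge0 ?(ltW e0)// mulr_ile1// ltW.
Qed.

End Cutoff.

(** * A finite cover by good charts *)

Section Compactification.
Context {R : realType} {n : nat} {M : ptopologicalType}.
Variable A : smooth_atlas R n M.
Local Notation E := 'rV[R]_n.+1.
Local Notation dom := (@dom _ _ _ A).
Local Notation chart := (@chart _ _ _ A).
Local Notation chartV := (@chartV _ _ _ A).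
Local Notation chart_idx := (chart_idx A).
Local Notation inner := (inner A).
Local Notation bdry := (bdry A).
Variables (rho : M -> R) (gbar : metric_field A).
Hypothesis rho_def : defining_function A rho.
Hypothesis gbar_metric : is_metric 2 setT gbar.
Hypothesis grad_rho1 : forall i x, dom i x -> bdry x ->
  covector_norm2 (gbar i x) (dchart i rho x) = 1.

Lemma rho_ge0 x : 0 <= rho x.
Proof.
have [_ rho_in rho_bd _] := rho_def.
have [/rho_bd ->//|/rho_in/ltW//] := pselect (bdry x).
Qed.

Lemma rho_gt0_inner x : 0 < rho x -> inner x.
Proof. by have [_ _ rho_bd _] := rho_def; move=> rx /rho_bd r0; rewrite r0 ltxx in rx. Qed.

Lemma defining_function_continuous : continuous rho.
Proof.
have [srho _ _ _] := rho_def; move=> x.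
set i := chart_at A x; have dx : dom i x := dom_chart_at A x.
have /subspace_continuousP/(_ (chart i x)) := Ck_continuous (srho i 0%N).
move=> /(_ (ex_intro2 _ _ x dx erefl)) H.
have {}H : (rho \o chartV i) \o chart i @ nbhs x --> rho x.
  rewrite -[in X in _ --> X](chartK dx); exact: cvg_comp (cvg_chart dx) H.
apply: cvg_trans H; apply: near_eq_cvg.
have nd : nbhs x (dom i) by apply: open_nbhs_nbhs; split=> //; exact: dom_open.
by apply: filterS nd => y dy /=; rewrite chartK.
Qed.

(** At a boundary point the chart has to be one in which that point has height
    zero; at an inner point any chart will do, because [rho] is positive there. *)
Lemma local_bound z : exists i (C : R) (U : set M),
  [/\ 0 < C, open U, U z & forall x, U x ->
    [/\ dom i x, covector_norm2 (gbar i x) (dchart i rho x) <= 1 + C * rho x,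
        chart i x ord0 ord0 <= C * rho x, `|chart i x| <= C &
        \det (gbar i x) <= C]].
Proof.
have [srho rho_in rho_bd _] := rho_def.
have [gpos gC _] := gbar_metric.
suff [i dz iz] : exists2 i, dom i z & (chart i z ord0 ord0 != 0 -> 0 < rho z).
  have [V oV VE] := chart_open i.
  have := @chart_bound R n V (rho \o chartV i) (fun v => gbar i (chartV i v))
    (chart i z) oV.
  rewrite -VE => H; have {H}[|||||||C C0 HC] := H.
  - by exists z.
  - by move=> v [x dx <-]; rewrite chartK//; exact: gpos.
  - move=> a b; have := CkW (gC i a b); rewrite setIT; exact.
  - exact: srho.
  - by move=> v _; exact: rho_ge0.
  - move=> v [x dx <-] x0; have bx : bdry x by exists i.
    by rewrite /= chartK// rho_bd//; split=> //; exact: grad_rho1.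
  - by rewrite /= chartK.
  have nS := near_chart dz HC.
  exists i, C, (interior [set y | dom i y /\
      [/\ covector_norm2 (gbar i (chartV i (chart i y)))
           (grad (chart i @` dom i) (rho \o chartV i) (chart i y)) <=
           1 + C * (rho \o chartV i) (chart i y),
         chart i y ord0 ord0 <= C * (rho \o chartV i) (chart i y),
         `|chart i y| <= C & \det (gbar i (chartV i (chart i y))) <= C]]).
  split => //; first exact: open_interior.
  by move=> x /interior_subset[dx]; rewrite /= chartK// => -[*]; split.
have [[i dz z0]|iz] := pselect (bdry z).
  by exists i => //; rewrite z0 eqxx.
exists (chart_at A z); first exact: dom_chart_at.
by move=> _; exact: rho_in.
Qed.

(** A constant that works on one chart works with any larger one, so the sum of
    the constants over a finite subcover serves for all its charts at once. *)
Lemma finite_chart_cover : compact [set: M] ->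
  exists (C : R) (s : seq M) (i : M -> chart_idx) (U : M -> set M),
  [/\ 1 <= C, forall z, open (U z), forall x, exists2 z, z \in s & U z x &
    forall z x, z \in s -> U z x ->
    [/\ dom (i z) x,
        covector_norm2 (gbar (i z) x) (dchart (i z) rho x) <= 1 + C * rho x,
        chart (i z) x ord0 ord0 <= C * rho x, `|chart (i z) x| <= C &
        \det (gbar (i z) x) <= C]].
Proof.
have [iC iCP] := choice local_bound.
have [CC CCP] := choice iCP; have [U UP] := choice CCP.
rewrite compact_cover => /(_ M setT U)[].
- by move=> z _; have [] := UP z.
- by move=> x _; exists x => //; have [] := UP x.
move=> D _ cD; pose C := 1 + \sum_(z <- finmap.enum_fset D) CC z.
have CC0 z : 0 <= CC z by have [/ltW] := UP z.
exists C, (finmap.enum_fset D), iC, U; split.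
- by rewrite lerDl sumr_ge0.
- by move=> z; have [] := UP z.
- by move=> x; have [z zD Uz] := cD x I; exists z.
move=> z x zD Uzx; have [_ _ _ /(_ x Uzx)[dx Nx hx nx detx]] := UP z.
have CzC : CC z <= C.
  rewrite /C (big_rem z)//= addrCA lerDl addr_ge0// sumr_ge0//.
have CzrC : CC z * rho x <= C * rho x by rewrite ler_wpM2r// rho_ge0.
split => //; try exact: le_trans CzC.
  by apply: le_trans Nx _; rewrite lerD2l.
exact: le_trans CzrC.
Qed.

End Compactification.

(** * The shell around a level set of the defining function *)

Section Capacity.
Context {R : realType} {n : nat} {M : ptopologicalType}.
Variable A : smooth_atlas R n M.
Local Notation E := 'rV[R]_n.+1.
Local Notation e_ j := (delta_mx ord0 j : E).
Local Notation dom := (@dom _ _ _ A).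
Local Notation chart := (@chart _ _ _ A).
Local Notation chartV := (@chartV _ _ _ A).
Local Notation chart_idx := (chart_idx A).
Local Notation inner := (inner A).

(** The chart image of [B] lies in a box of height [a] and width [2 * D]. *)
Lemma volume_chart_le (g : metric_field A) i (B : set M) (a D Q : R) :
  measurable (B : set (borel_mfd (M := M))) -> B `<=` dom i `&` inner ->
  0 <= a -> 0 <= D -> 0 <= Q ->
  (forall x, B x -> [/\ chart i x ord0 ord0 <= a, `|chart i x| <= D &
    Num.sqrt (\det (g i x)) <= Q]) ->
  (volume g B <= (Q * (a * (D + D) ^+ n))%:E)%E.
Proof.
move=> mB Bi a0 D0 Q0 HB.
apply: le_trans (mu_ext_le (volume_gauge0 g) mB) _.
apply: (@le_trans _ _ (\int[lebesgue_rV_measure R n]_(v in chart i @` B)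
      (Num.sqrt (\det (g i (chartV i v))))%:E)%E).
  by apply: ereal_inf_lbound; exists i.
rewrite EFinM; apply: (@integral_le_support _ _ R (lebesgue_rV_measure R n) _ (chart i @` B)) => //.
  move=> v [x Bx <-]; rewrite !lee_fin sqrtr_ge0/=.
  have [dx _] := Bi _ Bx; rewrite chartK//.
  by have [] := HB _ Bx.
move=> U _ UB.
pose lo : E := \row_k (if k == ord0 then 0 else - D).
pose hi : E := \row_k (if k == ord0 then a else D).
have Ubox : U `<=` box lo hi.
  move=> v /UB[x Bx <-] k; rewrite !mxE.
  have [dx ix] := Bi _ Bx; have [xa xD _] := HB _ Bx.
  have [->|_] := eqVneq k ord0; first by rewrite xa andbT ltW// coord_inner_gt0.
  by rewrite -ler_norml (le_trans (coord_le_norm _ _)).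
apply: (@le_trans _ _ (lebesgue_rV (box lo hi))).
  exact: (le_outer_measure (@lebesgue_rV_outer R n)).
apply: le_trans (lebesgue_box_le _) _.
  move=> k; rewrite !mxE; case: ifP => // _.
  by rewrite (@le_trans _ _ 0)// oppr_le0.
rewrite lee_fin big_ord_recl !mxE/= subr0 ler_wpM2l//.
rewrite (eq_bigr (fun=> D + D)); last by move=> k _; rewrite !mxE/= opprK.
by rewrite prodr_const card_ord.
Qed.

Variables (rho : M -> R) (gplus gbar : metric_field A).
Hypothesis rho_def : defining_function A rho.
Hypothesis gbar_metric : is_metric 2 setT gbar.
Hypothesis conformal : forall i x, dom i x -> inner x ->
  gbar i x = rho x ^+ 2 *: gplus i x.

Lemma gplusE i x : dom i x -> inner x -> gplus i x = (rho x ^+ 2)^-1 *: gbar i x.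
Proof.
move=> dx ix; rewrite (conformal dx ix) scalerA mulVf ?scale1r//.
have [_ /(_ x ix) rx _ _] := rho_def.
by rewrite sqrf_eq0 gt_eqF.
Qed.

Variables (C : R) (s : seq M) (idx : M -> chart_idx) (U : M -> set M).
Hypothesis C_ge1 : 1 <= C.
Hypothesis U_open : forall z, open (U z).
Hypothesis U_cover : forall x, exists2 z, z \in s & U z x.
Hypothesis U_bound : forall z x, z \in s -> U z x ->
  [/\ dom (idx z) x,
    covector_norm2 (gbar (idx z) x) (dchart (idx z) rho x) <= 1 + C * rho x,
    chart (idx z) x ord0 ord0 <= C * rho x, `|chart (idx z) x| <= C &
    \det (gbar (idx z) x) <= C].

(** The bound holds in a chart of the cover, and the norm of [d rho] does not
    depend on the chart. *)
Lemma grad_rho_le i x : dom i x -> inner x ->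
  covector_norm2 (gbar i x) (dchart i rho x) <= 1 + C * rho x.
Proof.
move=> dx ix; have [srho _ _ _] := rho_def.
have [z zs Uzx] := U_cover x; have [dzx Nx _ _ _] := U_bound zs Uzx.
by rewrite (covector_norm2_chart gbar_metric srho dx dzx ix).
Qed.

Definition shell (e : R) : set M := [set x | e / 2 <= rho x <= e].

(** In each chart of the cover the shell lies in a slab of thickness
    proportional to [e], and the volume density there is of order
    [e ^- n.+1]. *)
Lemma volume_shell_le (e : R) : 0 < e ->
  (volume gplus (shell e) <=
    ((size s)%:R * (2 ^+ n.+1 * Num.sqrt C * (C * (C + C) ^+ n) * e ^- n))%:E)%E.
Proof.
move=> e0; have C0 : 0 <= C by apply: le_trans C_ge1.
have crho := defining_function_continuous rho_def.
have shell_closed : closed (shell e).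
  have -> : shell e = rho @^-1` `[e / 2, e].
    by apply/seteqP; split => x; rewrite /shell/= in_itv.
  by apply: preimage_closed; [move=> x _; exact: crho | exact: itv_closed].
have shell_pos x : shell e x -> 0 < rho x.
  by move=> /andP[+ _]; apply: lt_le_trans; rewrite divr_gt0.
have shell_cover : shell e `<=` \big[setU/set0]_(z <- s) (shell e `&` U z).
  move=> x ex; have [z zs Uzx] := U_cover x.
  by rewrite -bigcup_seq; exists z.
apply: (@le_trans _ _ (volume gplus (\big[setU/set0]_(z <- s) (shell e `&` U z)))).
  exact: (le_outer_measure (volume_outer gplus)).
apply: le_trans (outer_measure_seq_cover (volume_outer gplus) _ _) _.
rewrite -sum1_size natr_sum mulr_suml -sumEFin big_seq [leRHS]big_seq.
apply: lee_sum => z zs; rewrite mul1r.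
have -> : 2 ^+ n.+1 * Num.sqrt C * (C * (C + C) ^+ n) * e ^- n =
    ((e / 2) ^- n.+1 * Num.sqrt C) * ((C * e) * (C + C) ^+ n).
  rewrite exprMn exprVn invfM invrK exprS [e ^+ n.+1]exprS.
  by field; rewrite expf_neq0 gt_eqF.
apply: (@volume_chart_le gplus (idx z)) => //.
- apply: measurableI; last by apply: sub_sigma_algebra; exact: U_open.
  rewrite -[shell e]setCK; apply: measurableC; apply: sub_sigma_algebra.
  exact: closed_openC.
- move=> x [ex Uzx]; have [dzx _ _ _ _] := U_bound zs Uzx.
  by split => //; apply: (rho_gt0_inner rho_def); exact: shell_pos.
- by rewrite mulr_ge0// ltW.
- by rewrite mulr_ge0 ?sqrtr_ge0// invr_ge0 exprn_ge0// divr_ge0// ltW.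
move=> x [ex Uzx]; have [dzx _ hx nx detx] := U_bound zs Uzx.
have rx := shell_pos _ ex.
have ix : inner x by exact: rho_gt0_inner rho_def _ rx.
have [er re] := andP ex.
split=> //; first by apply: le_trans hx _; rewrite ler_wpM2l.
(* [\det (gplus)] is [rho ^- (2 * n.+1)] times [\det (gbar)]. *)
rewrite (gplusE dzx ix) detZ -exprVn -exprM mulnC exprM sqrtrM; last first.
  exact: sqr_ge0.
rewrite sqrtr_sqr ger0_norm; last by rewrite exprn_ge0// invr_ge0 ltW.
rewrite exprVn ler_pM//.
- by rewrite invr_ge0 exprn_ge0// ltW.
- rewrite lef_pV2 ?posrE ?exprn_gt0 ?divr_gt0//.
  by apply: lerXn2r er; rewrite nnegrE ltW// divr_gt0.
- exact: ler_wsqrtr.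
Qed.

Lemma grad_norm_comp (phi dphi : R -> R) x : inner x ->
  is_derive (rho x) 1 phi (dphi (rho x)) ->
  grad_norm gplus (phi \o rho) x <=
    `|dphi (rho x)| * rho x * Num.sqrt (1 + C * rho x) /\
  (dphi (rho x) = 0 -> grad_norm gplus (phi \o rho) x = 0).
Proof.
move=> ix dphix; have [srho /(_ x ix) rx _ _] := rho_def.
rewrite /grad_norm; set i := chart_at A x.
have dx : dom i x := dom_chart_at A x.
have gpos : posdef (gbar i x) by have [H _ _] := gbar_metric; exact: H.
have dE : dchart i (phi \o rho) x = dphi (rho x) *: dchart i rho x.
  apply/rowP => j; rewrite !mxE.
  have nv := nbhs_chart_dom dx ix; set v := chart i x in nv *.
  rewrite !(pder_interior _ _ nv).
  have dF : derivable (rho \o chartV i) v (e_ j).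
    exact (Ck1_derivable (j := j) nv (srho i 1%N)).
  have H1 : is_derive (0 : R) 1 (fun t : R => (rho \o chartV i) (t *: e_ j + v))
      ('D_(e_ j) (rho \o chartV i) v).
    have := @is_derive_line R n (rho \o chartV i) v j 0.
    by rewrite scale0r add0r; apply.
  have := @derive_line R n ((phi \o rho) \o chartV i) v j 0.
  rewrite scale0r add0r => <-.
  have H2 : is_derive (0 : R) 1
     (phi \o (fun t : R => (rho \o chartV i) (t *: e_ j + v)))
     (dphi (rho x) * 'D_(e_ j) (rho \o chartV i) v).
    apply: is_derive1_comp; rewrite /= scale0r add0r chartK//.
  by have [_ <-] := H2.
have NE : covector_norm2 (gplus i x) (dchart i (phi \o rho) x) =
   (dphi (rho x) * rho x) ^+ 2 * covector_norm2 (gbar i x) (dchart i rho x).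
  rewrite dE (gplusE dx ix) covector_norm2Z ?sqrf_eq0 ?gt_eqF//; last first.
    exact: posdef_unit.
  rewrite /covector_norm2 linearZ/= -scalemxAr -!scalemxAl !mxE exprMn.
  by ring.
rewrite NE; split; last by move=> ->; rewrite mul0r expr0n mul0r sqrtr0.
rewrite sqrtrM ?sqr_ge0// sqrtr_sqr normrM (gtr0_norm rx).
rewrite ler_wpM2l ?mulr_ge0 ?(ltW rx)//; apply: ler_wsqrtr.
exact: grad_rho_le.
Qed.

End Capacity.

(** * The capacity bound *)

Section LogPotential.
Context {R : realType}.
Implicit Types C s : R.

Lemma is_derive_log_potential C s : 0 <= C -> 0 < s ->
  is_derive s 1 (fun s => ln s - ln (1 + C * s)) (s^-1 - C / (1 + C * s)).
Proof.
move=> C0 s0; have Cs : 0 < 1 + C * s by rewrite ltr_wpDr// mulr_ge0// ltW.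
have H1 : is_derive s 1 (@ln R) s^-1 by exact: is_derive1_ln.
have Ha : is_derive s 1 (fun s => 1 + C * s) C.
  by apply: is_derive_eq; rewrite add0r mul1r; exact: mulr1.
have H2 : is_derive s 1 (@ln R \o (fun s => 1 + C * s)) ((1 + C * s)^-1 * C).
  by apply: is_derive1_comp; exact: is_derive1_ln.
have -> : (fun s => ln s - ln (1 + C * s)) = @ln R - (@ln R \o (fun s => 1 + C * s)).
  by apply/funext.
by apply: is_derive_eq; rewrite [_ * C]mulrC.
Qed.

(** The derivative is [(s * (1 + C * s))^-1]: the correction [ln (1 + C * s)] is
    there to absorb the excess of the norm of [d rho] over 1. *)
Lemma log_potential_slope C s : 0 <= C -> 0 < s ->
  `|s^-1 - C / (1 + C * s)| * s * Num.sqrt (1 + C * s) <= 1.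
Proof.
move=> C0 s0; have Cs : 1 <= 1 + C * s by rewrite lerDl mulr_ge0// ltW.
have Cs0 : 0 < 1 + C * s by exact: lt_le_trans Cs.
have -> : s^-1 - C / (1 + C * s) = (s * (1 + C * s))^-1.
  by field; rewrite !gt_eqF.
rewrite ger0_norm; last by rewrite invr_ge0 mulr_ge0 ?ltW.
rewrite invfM [s^-1 * _]mulrC divfK ?gt_eqF// [leLHS]mulrC ler_pdivrMr// mul1r.
apply: (@le_trans _ _ (Num.sqrt ((1 + C * s) ^+ 2))).
  by apply: ler_wsqrtr; rewrite expr2 ler_peMr// ltW.
by rewrite sqrtr_sqr ger0_norm// ltW.
Qed.

End LogPotential.

Theorem theorem1p8 (R : realType) (n : nat) (M : ptopologicalType)
    (A : smooth_atlas R n M) (gplus : metric_field A) (q : M) (p : R) :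
  hausdorff_space M -> compact [set: M] -> connected [set: M] ->
  asymptotically_hyperbolic 2 gplus ->
  inner A q -> 1 < p ->
  exists C : R, \forall t \near +oo,
    (capacity gplus p (geoball gplus q t) <= (C * expR (n%:R * t))%:E)%E.
Proof.
move=> _ compM _ [_ gplus_metric _ _ [rho [gbar [[rho_def gbar_metric conf]]]]].
move=> grad1 iq p1.
have [srho rho_in rho_bd _] := rho_def.
have [C [s [idx [U [C1 oU cU bU]]]]] :=
  finite_chart_cover rho_def gbar_metric grad1 compM.
have C0 : 0 <= C by exact: le_trans C1.
have grad_le := grad_rho_le rho_def gbar_metric cU bU.
pose L (r : R) := ln r - ln (1 + C * r).
(* [L \o rho] is 1-Lipschitz and [L <= ln]. *)
have ball_rho t x : geoball gplus q t x -> expR (L (rho q) - t) <= rho x.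
  move=> [ix dqx]; have rx := rho_in _ ix.
  have Crx : 1 <= 1 + C * rho x by rewrite lerDl mulr_ge0// ltW.
  have := @geodist_ge R n M A rho gplus gbar C rho_def gbar_metric gplus_metric
    conf grad_le L (fun r => r^-1 - C / (1 + C * r)) 1 _ _ _ q x ltr01 ix.
  rewrite mul1e => H.
  have {H} : (`|L (rho q) - L (rho x)|%:E <= t%:E)%E.
    apply: le_trans (H _ _ _) dqx => r r0.
    - exact: is_derive_log_potential.
    - have Cr : 1 + C * r != 0 by rewrite gt_eqF// ltr_wpDr// mulr_ge0// ltW.
      apply: cvgB; first by apply: cvgV; [rewrite gt_eqF | exact: cvg_id].
      apply: cvgM; first exact: cvg_cst.
      apply: cvgV => //; apply: cvgD; first exact: cvg_cst.
      by apply: cvgM; [exact: cvg_cst | exact: cvg_id].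
    - exact: log_potential_slope.
  rewrite lee_fin => /(le_trans (ler_norm _)) LqLx.
  apply: (@le_trans _ _ (expR (ln (rho x)))); last by rewrite lnK.
  rewrite ler_expR; have := ln_ge0 Crx; rewrite /L in LqLx *; lra.
(* The slope of the cutoff is at most [8 / e], and it is used for [rho <= e <= 1]. *)
pose K := 8 * Num.sqrt (1 + C).
have K0 : 0 < K by rewrite mulr_gt0// sqrtr_gt0 ltr_wpDr.
pose W := (size s)%:R * (2 ^+ n.+1 * Num.sqrt C * (C * (C + C) ^+ n)).
exists (K `^ p * W * expR (- (n%:R * L (rho q)))).
near=> t.
set e := expR (L (rho q) - t).
have e0 : 0 < e by exact: expR_gt0.
have e1 : e <= 1.
  rewrite -[leRHS]expR0 ler_expR subr_le0; near: t.
  by apply: nbhs_pinfty_ge; exact: num_real.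
have [phi [dphi [phiD cdphi phi0 phi1 dphi_le]]] := cutoff_exists e0.
have slope r : 0 < r -> `|dphi r| * r * Num.sqrt (1 + C * r) <= K.
  move=> r0; have [dle dsupp] := dphi_le r.
  have [->|/dsupp/andP[_ re]] := eqVneq (dphi r) 0.
    by rewrite normr0 !mul0r ltW.
  rewrite ler_pM ?mulr_ge0// ?(ltW r0) ?sqrtr_ge0//.
    have -> : (8 : R) = 8 / e * e by rewrite divfK// gt_eqF.
    by rewrite ler_pM// ltW.
  apply: ler_wsqrtr; rewrite lerD2l -[leRHS]mulr1 ler_wpM2l//.
  exact: le_trans e1.
pose u := phi \o rho.
apply: (@le_trans _ _
  (\int[volume_measure gplus]_(x in inner A) (grad_norm gplus u x `^ p)%:E)%E).
  apply: ereal_inf_lbound; exists u => //; split.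
  - exists K; first exact: ltW.
    move=> x y ix iy.
    apply: (@geodist_ge R n M A rho gplus gbar C rho_def gbar_metric gplus_metric
      conf grad_le phi dphi K _ _ slope x y K0 iy) => r _.
    exact: cdphi.
  - exists [set x | e / 2 <= rho x]; last first.
      move=> x ix /negP; rewrite -ltNge => /ltW rx.
      exact: phi0.
    split.
      apply: subclosed_compact compM _ => //.
      have -> : [set x | e / 2 <= rho x] = rho @^-1` [set r | e / 2 <= r] by [].
      apply: preimage_closed; last exact: closed_ge.
      by move=> x _; exact: defining_function_continuous rho_def x.
    move=> x ex; apply: (rho_gt0_inner rho_def); apply: lt_le_trans ex.
    by rewrite divr_gt0.
  - by move=> x /ball_rho xe; exact: phi1.
have grad_u x : inner A x -> grad_norm gplus u x <= K /\
    (grad_norm gplus u x != 0 -> shell rho e x).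
  move=> ix; have rx := rho_in _ ix.
  have [le1 eq0] := grad_norm_comp rho_def gbar_metric conf cU bU ix (phiD (rho x)).
  split; first exact: le_trans le1 (slope _ rx).
  move=> gu; apply: (dphi_le (rho x)).2.
  by apply: contra_neq gu; exact: eq0.
have p0 : 0 <= p by apply: ltW; apply: lt_trans p1.
apply: (@le_trans _ _ ((K `^ p)%:E * volume gplus (shell rho e))%E).
  apply: (@integral_le_support _ _ R (volume_measure gplus) _ (shell rho e)).
  - exact: powR_ge0.
  - move=> x ix; rewrite !lee_fin powR_ge0/= ge0_ler_powR ?nnegrE ?sqrtr_ge0 ?(ltW K0)//.
    exact: (grad_u x ix).1.
  - move=> x ix gu; apply: (grad_u x ix).2; apply: contra_neq gu => ->.
    by rewrite powR0// gt_eqF// (lt_trans _ p1).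
  - move=> V _ VS; exact: (le_outer_measure (volume_outer gplus)).
apply: (@le_trans _ _ ((K `^ p)%:E * (W * e ^- n)%:E)%E).
  apply: lee_wpmul2l; first by rewrite lee_fin powR_ge0.
  have := volume_shell_le rho_def conf C1 oU cU bU e0.
  by rewrite /W -(mulrA (size s)%:R).
rewrite -EFinM lee_fin -!mulrA ler_wpM2l ?powR_ge0//.
rewrite -expRD (_ : e ^- n = expR (- (n%:R * L (rho q)) + n%:R * t))//.
by rewrite -exprVn -expRN -expRM_natl; congr expR; ring.
Unshelve. all: by end_near. Qed.
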